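(* Let $M$ be a complete (pointed) metric space. Then the following are equivalent: (i) the Lipschitz-free space $\mathcal{F}(M)$ is (linearly) isometrically isomorphic to a subspace of $\ell_1(\Gamma)$ for some set $\Gamma$; (ii) $M$ is (isometric to) a subset of an $\mathbb{R}$-tree such that $\lambda(M)=0$ and $\lambda(\overline{\mathrm{Br}(M)})=0$.
   Context: All Banach spaces are real. For a metric space $(M,d)$ with a base point $0\in M$, $\mathrm{Lip}_0(M)$ is the Banach space of all Lipschitz functions $f\colon M\to\mathbb{R}$ with $f(0)=0$, normed by the Lipschitz constant $\|f\|_L$. Let $\delta\colon M\to \mathrm{Lip}_0(M)^*$, $\langle f,\delta(x)\rangle=f(x)$. The Lipschitz-free space is $\mathcal{F}(M)=\overline{\mathrm{span}}\,\delta(M)\subset \mathrm{Lip}_0(M)^*$. An $\mathbb{R}$-tree is an arc-connected metric space $(T,d)$ such that any two points $x\neq y$ are joined by a unique arc, and this arc is isometric to the real segment $[0,d(x,y)]$. The arc is denoted $[x,y]$ and called a segment; $\phi_{xy}\colon[x,y]\to[0,d(x,y)]$ denotes the isometry. A point $x\in T$ is a branching point of $T$ if $T\setminus\{x\}$ has at least three connected components; $\mathrm{Br}(T)$ is the set of branching points. Length measure $\lambda$ on $T$: a set $E\subset[x,y]$ is measurable if $\phi_{xy}(E)$ is Lebesgue measurable, and then $\lambda(E)$ is the Lebesgue measure of $\phi_{xy}(E)$. An arbitrary $E\subset T$ is measurable if $E\cap I$ is measurable for every segment $I$ of $T$, and then $\lambda(E)=\sup\{\sum_{k=1}^n\lambda(E\cap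 I_k): I_1,\dots,I_n \text{ disjoint segments in } T\}$. If a metric space $M$ is a subset of an $\mathbb{R}$-tree, there is, up to isometry, a unique minimal $\mathbb{R}$-tree containing $M$, denoted $\mathrm{conv}(M)$; if $M\subset T$ with $T$ an $\mathbb{R}$-tree it may be realized as the union of the segments $[x,y]\subset T$ with $x,y\in M$. The length measure on $M$ is the restriction of that of $\mathrm{conv}(M)$, and $\mathrm{Br}(M):=\mathrm{Br}(\mathrm{conv}(M))$ (these points need not belong to $M$). The closure $\overline{\mathrm{Br}(M)}$ is taken in $\mathrm{conv}(M)$. *)

(* Defs.v *)
From HB Require Import structures.
From mathcomp Require Import all_boot all_order all_algebra.
From mathcomp Require Import all_classical all_reals all_analysis.

Set Implicit Arguments.
Unset Strict Implicit.
Unset Printing Implicit Defensive.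

Import Order.TTheory GRing.Theory Num.Theory.
Import numFieldNormedType.Exports.

Local Open Scope classical_set_scope.
Local Open Scope ring_scope.

(* The library's Complete structure includes a distinguished point; it plays no
   role below, where the base point o of M is an explicit parameter. *)
#[short(type="completeMetricType")]
HB.structure Definition CompleteMetric (R : numDomainType) :=
  {M of Complete M & Metric R M}.

Section dual.
Context (R : realType) (E : normedModType R).

Definition continuous_linear : {pred E -> R} :=
  fun f => `[< linear f /\ continuous f >].

Record dual := Dual {
  dual_fun :> E -> R ;
  dual_funP : dual_fun \in continuous_linear }.

HB.instance Definition _ := [isSub for dual_fun].
HB.instance Definition _ := [Choice of dual by <:].

Lemma continuous_linear_submod_closed : submod_closed continuous_linear.
Proof.
split.
  apply/asboolP; split => [a x y|x]; last exact: cvg_cst.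
  by rewrite /= scaler0 addr0.
move=> a f g /asboolP[lf cf] /asboolP[lg cg]; apply/asboolP; split.
  move=> b x y; rewrite !fctE lf lg !scalerDr !scalerA [b * a]mulrC.
  by rewrite addrACA.
by move=> x; apply: cvgD; [apply: cvgZl_tmp; exact: cf|exact: cg].
Qed.

HB.instance Definition _ :=
  GRing.isSubmodClosed.Build _ _ continuous_linear
    continuous_linear_submod_closed.
HB.instance Definition _ := [SubChoice_isSubLmodule of dual by <:].

Definition dual_norm (f : dual) : R :=
  sup [set `|f x| | x in [set x | `|x| <= 1]].

Lemma dual_linear (f : dual) : linear f.
Proof. by have /asboolP[] := dual_funP f. Qed.

HB.instance Definition _ (f : dual) :=
  GRing.isLinear.Build R E R *:%R f (@dual_linear f).

Lemma dual_continuous (f : dual) : continuous f.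
Proof. by have /asboolP[] := dual_funP f. Qed.

Lemma has_ubound_dual (f : dual) :
  has_ubound [set `|f x| | x in [set x | `|x| <= 1]].
Proof.
have /linear_boundedP/pinfty_ex_gt0[k k0 fk] : bounded_near f (nbhs 0).
  exact/linear_bounded_continuous/dual_continuous.
exists k => _ [x /= x1 <-]; apply: (le_trans (fk x)).
by rewrite ler_piMr// ltW.
Qed.

Lemma dual_normP (f : dual) x : `|f x| <= dual_norm f * `|x|.
Proof.
have [->|x0] := eqVneq x 0; first by rewrite linear0 !normr0 mulr0.
have nx0 : 0 < `|x| by rewrite normr_gt0.
rewrite -ler_pdivrMr//; apply: (ub_le_sup (has_ubound_dual f)).
exists (`|x|^-1 *: x) => /=.
  by rewrite normrZ ger0_norm ?invr_ge0// mulVf ?gt_eqF.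
by rewrite linearZ normrZ ger0_norm ?invr_ge0// mulrC.
Qed.

Lemma dual_norm_le (f : dual) k : (forall x, `|x| <= 1 -> `|f x| <= k) ->
  dual_norm f <= k.
Proof.
move=> fk; apply: ge_sup; last by move=> _ [x x1 <-]; exact: fk.
by exists `|f 0|, 0 => //=; rewrite normr0.
Qed.

Lemma dual_norm_ge (f : dual) x : `|x| <= 1 -> `|f x| <= dual_norm f.
Proof. by move=> x1; apply: (ub_le_sup (has_ubound_dual f)); exists x. Qed.

Lemma dual_normD f g : dual_norm (f + g) <= dual_norm f + dual_norm g.
Proof.
apply: dual_norm_le => x x1; apply: (le_trans (ler_normD _ _)).
by apply: lerD; exact: dual_norm_ge.
Qed.

Lemma dual_norm_eq0 f : dual_norm f = 0 -> f = 0.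
Proof.
move=> f0; apply/val_inj/funext => x; apply/normr0_eq0/le_anti.
by rewrite normr_ge0 andbT (le_trans (dual_normP f x))// f0 mul0r.
Qed.

Lemma dual_normZ a f : dual_norm (a *: f) = `|a| * dual_norm f.
Proof.
apply/le_anti/andP; split.
  apply: dual_norm_le => x x1; rewrite normrZ.
  by rewrite ler_wpM2l//; exact: dual_norm_ge.
have [->|a0] := eqVneq a 0.
  rewrite normr0 mul0r.
  by apply: le_trans (@dual_norm_ge _ 0 _) => //; rewrite normr0.
rewrite -ler_pdivlMl ?normr_gt0//; apply: dual_norm_le => x x1.
rewrite ler_pdivlMl ?normr_gt0// -normrM.
exact: (@dual_norm_ge (a *: f)).
Qed.

HB.instance Definition _ :=
  Lmodule_isNormed.Build R dual dual_normD dual_normZ dual_norm_eq0.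

End dual.

Section lip0.
Context (R : realType) (M : metricType R) (o : M).

Definition lipschitz0 : {pred M -> R} :=
  fun f => `[< f o = 0 /\
    exists k, forall x y, `|f x - f y| <= k * mdist x y >].

Record lip0 := Lip0 {
  lip0_fun :> M -> R ;
  lip0_funP : lip0_fun \in lipschitz0 }.

HB.instance Definition _ := [isSub for lip0_fun].
HB.instance Definition _ := [Choice of lip0 by <:].

Lemma lipschitz0_submod_closed : submod_closed lipschitz0.
Proof.
split.
  apply/asboolP; split => //; exists 0 => x y.
  by rewrite mul0r subrr normr0.
move=> a f g /asboolP[f0 [k fk]] /asboolP[g0 [l gl]]; apply/asboolP; split.
  by rewrite !fctE f0 g0 scaler0 addr0.
exists (`|a| * k + l) => x y; rewrite !fctE opprD addrACA -scalerBr.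
rewrite mulrDl -mulrA (le_trans (ler_normD _ _))// normrZ.
by rewrite lerD// ler_wpM2l.
Qed.

HB.instance Definition _ :=
  GRing.isSubmodClosed.Build _ _ lipschitz0 lipschitz0_submod_closed.
HB.instance Definition _ := [SubChoice_isSubLmodule of lip0 by <:].

(* Pairs with p.1 = p.2 contribute 0 / 0 = 0 to the supremum. *)
Definition lip0_norm (f : lip0) : R :=
  sup (range (fun p : M * M => `|f p.1 - f p.2| / mdist p.1 p.2)).

Lemma lip0_base (f : lip0) : f o = 0.
Proof. by have /asboolP[] := lip0_funP f. Qed.

Lemma has_ubound_lip0 (f : lip0) :
  has_ubound (range (fun p : M * M => `|f p.1 - f p.2| / mdist p.1 p.2)).
Proof.
have /asboolP[_ [k fk]] := lip0_funP f.
exists `|k| => _ [[x y] _ <-] /=.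
have [<-|xy] := eqVneq x y; first by rewrite mdistxx invr0 mulr0.
rewrite ler_pdivrMr ?mdist_gt0// (le_trans (fk x y))//.
by rewrite ler_wpM2r ?mdist_ge0// ler_norm.
Qed.

Lemma lip0_normP (f : lip0) x y : `|f x - f y| <= lip0_norm f * mdist x y.
Proof.
have [->|xy] := eqVneq x y; first by rewrite subrr normr0 mdistxx mulr0.
rewrite -ler_pdivrMr ?mdist_gt0//.
by apply: (ub_le_sup (has_ubound_lip0 f)); exists (x, y).
Qed.

Lemma lip0_norm_ge0 (f : lip0) : 0 <= lip0_norm f.
Proof.
apply: (ub_le_sup (has_ubound_lip0 f)); exists (o, o) => //=.
by rewrite subrr normr0 mul0r.
Qed.

Lemma lip0_norm_le (f : lip0) k : 0 <= k ->
  (forall x y, `|f x - f y| <= k * mdist x y) -> lip0_norm f <= k.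
Proof.
move=> k0 fk; apply: ge_sup; first by exists (`|f o - f o| / mdist o o), (o, o).
move=> _ [[u v] _ <-] /=; have [<-|uv] := eqVneq u v.
  by rewrite mdistxx invr0 mulr0.
by rewrite ler_pdivrMr ?mdist_gt0.
Qed.

Lemma lip0_normD f g : lip0_norm (f + g) <= lip0_norm f + lip0_norm g.
Proof.
apply: lip0_norm_le; first by rewrite addr_ge0// lip0_norm_ge0.
move=> x y; rewrite [leLHS](_ : _ = `|(f x - f y) + (g x - g y)|).
  by rewrite mulrDl (le_trans (ler_normD _ _))// lerD// lip0_normP.
by rewrite addrACA -opprD.
Qed.

Lemma lip0_norm_eq0 f : lip0_norm f = 0 -> f = 0.
Proof.
move=> f0; apply/val_inj/funext => x /=; apply/normr0_eq0/le_anti.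
rewrite normr_ge0 andbT; have := lip0_normP f x o.
by rewrite f0 mul0r lip0_base subr0.
Qed.

Lemma lip0_normZ a f : lip0_norm (a *: f) = `|a| * lip0_norm f.
Proof.
apply/le_anti/andP; split.
  apply: lip0_norm_le; first by rewrite mulr_ge0// lip0_norm_ge0.
  move=> x y; rewrite [leLHS](_ : _ = `|a| * `|f x - f y|).
    by rewrite -mulrA ler_wpM2l// lip0_normP.
  by rewrite -normrM mulrBr.
have [->|a0] := eqVneq a 0; first by rewrite normr0 mul0r lip0_norm_ge0.
rewrite -ler_pdivlMl ?normr_gt0//; apply: lip0_norm_le.
  by rewrite mulr_ge0 ?invr_ge0// lip0_norm_ge0.
move=> x y; rewrite -mulrA ler_pdivlMl ?normr_gt0// -normrM mulrBr.
exact: (lip0_normP (a *: f)).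
Qed.

HB.instance Definition _ :=
  Lmodule_isNormed.Build R lip0 lip0_normD lip0_normZ lip0_norm_eq0.

Lemma delta_subproof (x : M) :
  (fun f : lip0 => f x) \in @continuous_linear R lip0.
Proof.
have lin : linear (fun f : lip0 => f x) by [].
apply/asboolP; split => //.
pose e := HB.pack_for {linear lip0 -> R} (fun f : lip0 => f x)
  (GRing.isLinear.Build R lip0 R *:%R _ lin).
apply: (@bounded_linear_continuous _ _ _ e).
apply/linear_boundedP; near=> r => f.
rewrite -[e f]subr0 -(lip0_base f) (le_trans (lip0_normP f x o))//.
rewrite mulrC; apply: ler_wpM2r; first exact: lip0_norm_ge0.
by near: r; apply: nbhs_pinfty_ge; exact: num_real.
Unshelve. all: by end_near. Qed.

Definition delta (x : M) : dual lip0 := Dual (delta_subproof x).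

Definition span_delta : set (dual lip0) :=
  [set v | exists n (a : 'I_n -> R) (x : 'I_n -> M),
    v = \sum_(i < n) a i *: delta (x i)].

Definition lipfree_pred : {pred dual lip0} := mem (closure span_delta).

Record lipfree := Lipfree {
  lipfree_val :> dual lip0 ;
  lipfree_valP : lipfree_val \in lipfree_pred }.

HB.instance Definition _ := [isSub for lipfree_val].
HB.instance Definition _ := [Choice of lipfree by <:].

Lemma span_delta_linear a u v :
  span_delta u -> span_delta v -> span_delta (a *: u + v).
Proof.
move=> [n [b [x ->]]] [m [c [y ->]]]; exists (n + m)%N.
exists (fun i : 'I_(n + m) =>
  match fintype.split i with inl j => a * b j | inr j => c j end).
exists (fun i : 'I_(n + m) =>
  match fintype.split i with inl j => x j | inr j => y j end).
rewrite big_split_ord scaler_sumr; congr (_ + _); apply: eq_bigr => i _ /=.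
  by have /= -> := unsplitK (inl i : 'I_n + 'I_m); rewrite scalerA.
by have /= -> := unsplitK (inr i : 'I_n + 'I_m).
Qed.

Lemma lipfree_submod_closed : submod_closed lipfree_pred.
Proof.
split.
  apply/mem_set/subset_closure; exists 0%N, (fun=> 0), (fun=> o).
  by rewrite big_ord0.
move=> a u v /set_mem uF /set_mem vF; apply/mem_set => B Bauv.
have : (a *: z.1 + z.2) @[z --> (u, v)] --> a *: u + v.
  by apply: cvgD; [apply: cvgZl_tmp; exact: cvg_fst|exact: cvg_snd].
move=> /(_ _ Bauv)[[U V]] /= [uU vV] UVB.
have [u' [u'F Uu']] := uF _ uU; have [v' [v'F Vv']] := vF _ vV.
exists (a *: u' + v'); split; first exact: span_delta_linear.
exact: (UVB (u', v')).
Qed.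

HB.instance Definition _ :=
  GRing.isSubmodClosed.Build _ _ lipfree_pred lipfree_submod_closed.
HB.instance Definition _ := [SubChoice_isSubLmodule of lipfree by <:].

Definition lipfree_norm (u : lipfree) : R := `|lipfree_val u|.

Lemma lipfree_normD u v :
  lipfree_norm (u + v) <= lipfree_norm u + lipfree_norm v.
Proof. exact: ler_normD. Qed.

Lemma lipfree_normZ a u : lipfree_norm (a *: u) = `|a| * lipfree_norm u.
Proof. exact: normrZ. Qed.

Lemma lipfree_norm_eq0 u : lipfree_norm u = 0 -> u = 0.
Proof. by move=> /normr0_eq0 u0; exact: val_inj. Qed.

HB.instance Definition _ :=
  Lmodule_isNormed.Build R lipfree lipfree_normD lipfree_normZ lipfree_norm_eq0.

End lip0.

Section ell1.
Context (R : realType) (I : choiceType).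

Definition summable_pred : {pred I -> R} :=
  fun f => `[< summable setT (EFin \o f) >].

Record ell1 := Ell1 {
  ell1_fun :> I -> R ;
  ell1_funP : ell1_fun \in summable_pred }.

HB.instance Definition _ := [isSub for ell1_fun].
HB.instance Definition _ := [Choice of ell1 by <:].

Definition ell1_norm (f : ell1) : R := fine (\esum_(i in [set: I]) `|f i|%:E).

Lemma esum_normZ a (f : I -> R) : summable setT (EFin \o f) ->
  (\esum_(i in [set: I]) `|a * f i|%:E <=
   `|a|%:E * \esum_(i in [set: I]) `|f i|%:E)%E.
Proof.
move=> sf; apply: ge_ereal_sup => _ [A [finA _] <-].
under eq_fsbigr do rewrite normrM EFinM.
rewrite -ge0_mule_fsumr//; apply: lee_wpmul2l => //.
by apply: ereal_sup_ubound; exists A.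
Qed.

Lemma summable_submod_closed : submod_closed summable_pred.
Proof.
split.
  apply/asboolP; rewrite /summable esum1 ?ltry// => i _ /=.
  by rewrite normr0.
move=> a f g /asboolP sf /asboolP sg; apply/asboolP.
have -> : EFin \o (a *: f + g) = ((EFin \o (a *: f)) \+ (EFin \o g))%E by [].
apply: summableD => //.
rewrite /summable (le_lt_trans (esum_normZ a sf))//.
by rewrite lte_mul_pinfty.
Qed.

HB.instance Definition _ :=
  GRing.isSubmodClosed.Build _ _ summable_pred summable_submod_closed.
HB.instance Definition _ := [SubChoice_isSubLmodule of ell1 by <:].

Lemma ell1_summable (f : ell1) : summable setT (EFin \o f).
Proof. exact/asboolP/(ell1_funP f). Qed.

Lemma ell1_normE (f : ell1) :
  (ell1_norm f)%:E = \esum_(i in [set: I]) `|f i|%:E.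
Proof.
by rewrite fineK//; have := ell1_summable f; rewrite summableE.
Qed.

Lemma ell1_normD f g : ell1_norm (f + g) <= ell1_norm f + ell1_norm g.
Proof.
rewrite -lee_fin EFinD !ell1_normE -esumD//.
by apply: le_esum => i _; rewrite -EFinD lee_fin ler_normD.
Qed.

Lemma ell1_normZ_le a f : ell1_norm (a *: f) <= `|a| * ell1_norm f.
Proof.
by rewrite -lee_fin EFinM !ell1_normE; exact/esum_normZ/ell1_summable.
Qed.

Lemma ell1_norm_ge (f : ell1) i : `|f i| <= ell1_norm f.
Proof.
rewrite -lee_fin ell1_normE; apply: esum_ge; exists [set i].
  by split => //; exact: finite_set1.
by rewrite fsbig_set1.
Qed.

Lemma ell1_normZ a f : ell1_norm (a *: f) = `|a| * ell1_norm f.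
Proof.
apply/le_anti; rewrite ell1_normZ_le/=.
have [->|a0] := eqVneq a 0.
  by rewrite normr0 mul0r -lee_fin ell1_normE esum_ge0.
rewrite -ler_pdivlMl ?normr_gt0// -normfV.
by apply: le_trans (ell1_normZ_le _ _); rewrite scalerA mulVf// scale1r.
Qed.

Lemma ell1_norm_eq0 f : ell1_norm f = 0 -> f = 0.
Proof.
move=> f0; apply/val_inj/funext => i; apply/normr0_eq0/le_anti.
by rewrite normr_ge0 andbT -f0 ell1_norm_ge.
Qed.

HB.instance Definition _ :=
  Lmodule_isNormed.Build R ell1 ell1_normD ell1_normZ ell1_norm_eq0.

End ell1.

Section rtree.
Context (R : realType) (T : metricType R).
Implicit Types (A C E : set T) (x y z : T).

(* As `[0, 1] is compact, such a g is a homeomorphism onto its image. *)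
Definition is_arc x y : set (set T) :=
  [set A | exists g : R -> T,
    [/\ {within `[0, 1], continuous g}, {in `[0, 1] &, injective g},
        g 0 = x, g 1 = y & A = g @` `[0, 1]]].

Definition rtree := forall x y, x != y -> exists A,
  [/\ is_arc x y A,
      forall B, is_arc x y B -> B = A
    & exists phi : T -> R, phi @` A = `[0, mdist x y]%classic /\
        {in A &, forall u v, `|phi u - phi v| = mdist u v}].

(* There is no arc from x to x: the union with [set x] makes
   segment x x = [set x], and changes nothing when x != y. *)
Definition segment x y : set T := x |` \bigcup_(A in is_arc x y) A.

Definition rconv A : set T :=
  [set z | exists x y, [/\ A x, A y & segment x y z]].

(* In branching and in the length measure below, C is a subset of an R-tree
   containing the segments between its points, considered as an R-tree in its
   own right. *)

Definition branching C : set T :=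
  [set x | C x /\
    (`I_3 #<= [set connected_component (C `\ x) y | y in C `\ x])%card].

Definition lebesgue_measurable : set (set R) :=
  ((wlength (@idfun R))^*)%mu.-cara.-measurable.

(* In an R-tree, the isometry of segment x y onto [0, d(x, y)] that maps x to 0
   is mdist x. *)
Definition length_measurable C E :=
  forall x y, C x -> C y ->
    lebesgue_measurable (mdist x @` (E `&` segment x y)).

Definition length_measure C E : \bar R :=
  ereal_sup [set s | exists n (x y : 'I_n -> T),
    [/\ forall k, C (x k) /\ C (y k),
        trivIset [set: 'I_n] (fun k => segment (x k) (y k))
      & s = (\sum_(k < n) completed_lebesgue_measure
               (mdist (x k) @` (E `&` segment (x k) (y k))))%E]].

Definition length_null C E := length_measurable C E /\ length_measure C E = 0%E.

End rtree.

(* Main.v *)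
From HB Require Import structures.
Require Import Defs.
From mathcomp Require Import all_boot all_order all_algebra.
From mathcomp Require Import all_classical all_reals all_analysis.
From mathcomp Require Import measurable_realfun lra ring.

(** Write phi x for the image of delta x under an isometric linear map from the
free space of M into an ell1 space, and [p, q] for a segment of an R-tree.

From the embedding to the tree. The functional delta x + delta y - 2 delta z
has norm d(x, z) + d(y, z), because the distance to z is 1-Lipschitz; so
phi x - phi z and phi y - phi z have coordinates of the same sign, for all
x, y and z. Hence no coordinate of phi takes three values on M
([coord_two_values]): each coordinate is a cut of M into two parts, with a
weight, and d is the sum of these cuts. A similar computation with four points
([molecule_pair_norm], [coord_cross]) shows that two cuts never separate four
points in two crossing ways. Since d is a sum of non-crossing cuts, it satisfies
the four-point condition ([coord_four_point]), and a four-point space spans an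
R-tree T, which is built here from pairs (x, t), the point at distance t from
the base point towards x.

For p and q in M, the cuts that separate p from q form a chain. Projecting M
onto [p, q], each of these cuts opens an interval of [p, q] free of projections;
the cuts that open the same interval have total weight at most its length
([gap_length]), while all the cuts together weigh d(p, q). So the closure of the
projection of M on [p, q] has length zero ([gaps_negligible]). It contains both
M and the closure of the branching points, because every branching point has the
same projection as some point of M ([branching_project]).

From the tree to the embedding. Let O be the base point and remove from conv M
the closed null set made of M and of the closure of the branching points. What is
left falls into gaps, which are open segments; since a gap contains neither
branching points nor points of M, each segment [O, x] with x in M contains it or
misses it ([gap_in_branch]). The function chi_g on M, which is the length of the
gap g at the points x with g inside [O, x] and zero elsewhere, is 1-Lipschitz,
and so is every signed sum of such functions ([gap_length_on_lipschitz]). Hence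
u |-> (u(chi_g))_g does not increase norms. Conversely, a 1-Lipschitz function
on M extends to T, and on [O, x] its increment is the sum of its increments over
the gaps because finitely many gaps nearly fill [O, x] ([gap_cover],
[lipschitz_increments]). So finite sums of the functions c_g chi_g with
|c_g| <= 1 approximate it on any finite set ([gap_approximation]), which gives
the reverse inequality for finite combinations of the functionals delta x, and
by density on the whole free space. *)

Set Implicit Arguments.
Unset Strict Implicit.
Unset Printing Implicit Defensive.

Import Order.TTheory GRing.Theory Num.Theory.
Import numFieldNormedType.Exports.

Local Open Scope classical_set_scope.
Local Open Scope ring_scope.

(** * Geodesics of R-trees and the four-point condition *)

Section metric_trees.
Context (R : realType) (T : metricType R).
Implicit Types (x y z w : T) (c : R -> T).

(** Among the three sums of distances over the pairings of four points, the two
largest are equal; it suffices to bound each sum by the larger of the others. *)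
Definition four_point := forall x y z w,
  mdist x y + mdist z w <= mdist x z + mdist y w \/
  mdist x y + mdist z w <= mdist x w + mdist y z.

Definition between x y : set T :=
  [set z | mdist x z + mdist z y = mdist x y].

Definition geodesic := forall x y s, 0 <= s <= mdist x y ->
  exists2 z, mdist x z = s & mdist z y = mdist x y - s.

Lemma nbhs_distP x (P : set T) :
  nbhs x P <-> exists2 e, 0 < e & forall y, mdist x y < e -> P y.
Proof. exact: metricType_numDomainType.nbhs_mdistP. Qed.

Lemma lipschitz_arc (g : R -> T) k :
  (forall s t, 0 <= s -> s <= t -> t <= 1 -> mdist (g s) (g t) <= k * (t - s)) ->
  {in `[0, 1] &, injective g} -> is_arc (g 0) (g 1) (g @` `[0, 1]).
Proof.
move=> gk gi; exists g; split => //.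
apply/subspace_continuousP => s /=; rewrite in_itv/= => /andP[s0 s1].
apply/metricType_numDomainType.cvgrPdist_lt => e e0.
pose k' := `|k| + 1; have k'0 : 0 < k' by rewrite ltr_wpDl.
have kk' : k <= k' by rewrite /k'; have := ler_norm k; lra.
apply/nbhs_ballP; exists (e / k') => /=; first exact: divr_gt0.
move=> t /=; rewrite /ball/= in_itv/= ltr_pdivlMr// => st /andP[t0 t1].
apply: le_lt_trans st; have [st|/ltW ts] := leP s t.
  apply: (le_trans (gk _ _ _ _ _)) => //; rewrite ler0_norm ?subr_le0//.
  by rewrite mulrC opprB ler_wpM2l ?subr_ge0.
rewrite metric_sym; apply: (le_trans (gk _ _ _ _ _)) => //.
by rewrite ger0_norm ?subr_ge0// mulrC ler_wpM2l ?subr_ge0.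
Qed.

Definition isopath c a := forall s t, 0 <= s -> s <= t -> t <= a ->
  mdist (c s) (c t) = t - s.

(** Uniqueness of arcs is exploited by gluing two isometric paths that meet only
at their common end: the result, rescaled to the unit interval, is an arc. *)
Lemma arc_concat c1 c2 a b : 0 <= a -> 0 <= b -> 0 < a + b ->
  isopath c1 a -> isopath c2 b -> c1 a = c2 0 ->
  (forall s t, 0 <= s <= a -> 0 <= t <= b -> c1 s = c2 t -> s = a /\ t = 0) ->
  exists A, [/\ is_arc (c1 0) (c2 b) A,
    forall s, 0 <= s <= a -> A (c1 s) & forall t, 0 <= t <= b -> A (c2 t)].
Proof.
move=> a0 b0 ab c1a c2b c12 cross.
pose g u := if u * (a + b) <= a then c1 (u * (a + b)) else c2 (u * (a + b) - a).
have gg u : 0 <= u -> u <= 1 -> 0 <= u * (a + b) /\ u * (a + b) <= a + b.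
  by move=> u0 u1; rewrite mulr_ge0 ?ler_piMl// ltW.
have g0 : g 0 = c1 0 by rewrite /g mul0r a0.
have g1 : g 1 = c2 b.
  rewrite /g mul1r; case: ifPn => [h|_]; last by congr c2; lra.
  have {}h : b = 0 by lra.
  by rewrite h addr0 c12.
have inv s : 0 <= s <= a + b -> exists2 u, 0 <= u <= 1 & u * (a + b) = s.
  move=> /andP[s0 sab]; exists (s / (a + b)).
    by rewrite divr_ge0 ?ler_pdivrMr ?mul1r//= ltW.
  by rewrite divfK// gt_eqF.
exists (g @` `[0, 1]); split.
- rewrite -g0 -g1; apply: (@lipschitz_arc _ (a + b)).
  + move=> s t s0 st t1; have t0 : 0 <= t by lra.
    have s1 : s <= 1 by lra.
    have [s0' s1'] := gg _ s0 s1; have [t0' t1'] := gg _ t0 t1.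
    have st' : s * (a + b) <= t * (a + b) by rewrite ler_wpM2r// ltW.
    have -> : (a + b) * (t - s) = t * (a + b) - s * (a + b) by ring.
    rewrite /g; case: ifPn => hs; case: ifPn => ht.
    * by rewrite c1a.
    * rewrite -ltNge in ht.
      apply: (le_trans (metric_triangle _ (c1 a) _)).
      rewrite c1a ?lexx// c12 c2b; lra.
    * lra.
    * rewrite -!ltNge in hs ht.
      rewrite c2b; lra.
  + move=> s t; rewrite !in_itv/= => /andP[s0 s1] /andP[t0 t1].
    wlog st : s t s0 s1 t0 t1 / s <= t.
      by move=> W; have [/W h|/ltW /W h /esym e] := leP s t; [exact: h|exact/esym/h].
    have [s0' s1'] := gg _ s0 s1; have [t0' t1'] := gg _ t0 t1.
    have st' : s * (a + b) <= t * (a + b) by rewrite ler_wpM2r// ltW.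
    suff: g s = g t -> s * (a + b) = t * (a + b).
      by move=> h /h /mulIf; apply; rewrite gt_eqF.
    rewrite /g; case: ifPn => hs; case: ifPn => ht.
    * move=> e; have := c1a _ _ s0' st' ht; rewrite e mdistxx; lra.
    * rewrite -ltNge in ht => e.
      by have [] := cross (s * (a + b)) (t * (a + b) - a) _ _ e; lra.
    * lra.
    * rewrite -!ltNge in hs ht => e.
      have := c2b (s * (a + b) - a) (t * (a + b) - a).
      rewrite e mdistxx; lra.
- move=> s /andP[s0 sa]; have [|u u01 us] := inv s; first lra.
  by exists u => //=; rewrite /g us sa.
- move=> t /andP[t0 tb]; have [|u u01 us] := inv (a + t); first lra.
  exists u => //=; rewrite /g us; case: ifPn => [h|_]; last by congr c2; lra.
  have -> : t = 0 by lra.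
  by rewrite addr0 c12.
Qed.

Lemma isopath0 c : isopath c 0.
Proof.
move=> s t s0 st t0; have [-> ->] : s = 0 /\ t = 0 by lra.
by rewrite mdistxx subrr.
Qed.

Lemma segmentxx x : segment x x = [set x].
Proof.
apply/seteqP; split => [z [//|[A [g [_ gi g0 g1 _]]]]|z ->]; last by left.
by have := oner_neq0 R; rewrite (gi 1 0) ?eqxx ?g0 ?g1 ?in_itv/= ?lexx ?ler01.
Qed.

Section from_rtree.
Hypothesis tT : rtree T.

Lemma rtree_segment x y A : x != y -> is_arc x y A -> segment x y = A.
Proof.
move=> xy xyA; have [B [_ uB _]] := tT xy.
have {}uB C : is_arc x y C -> C = A by move=> /uB ->; rewrite (uB _ xyA).
apply/seteqP; split => [z [->|[C /uB ->//]]|z Az]; last by right; exists A.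
have [g [_ _ <- _ ->]] := xyA; exists 0 => //=.
by rewrite in_itv/= lexx ler01.
Qed.

(** The definition of an R-tree provides an isometry from the arc onto an
interval; its inverse, reversed if it starts at the wrong end, is a unit-speed
parametrization. *)
Lemma rtree_path x y : exists c, [/\ isopath c (mdist x y), c 0 = x,
  c (mdist x y) = y &
  segment x y = c @` `[0, mdist x y]].
Proof.
have [<-|xy] := eqVneq x y.
  exists (fun=> x); rewrite mdistxx segmentxx; split => //.
    exact: isopath0.
  apply/seteqP; split => [z ->|z [s _ <-//]].
  by exists 0 => //=; rewrite in_itv/= lexx.
have [A [xyA _ [phi [phiA phi_iso]]]] := tT xy.
have d0 : 0 < mdist x y by rewrite mdist_gt0.
rewrite (rtree_segment xy xyA).
have [Ax Ay] : A x /\ A y.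
  have [g [_ _ <- <- ->]] := xyA.
  by split; [exists 0|exists 1] => //=; rewrite in_itv/= ?lexx ler01.
have phi01 z : A z -> 0 <= phi z <= mdist x y.
  by move=> Az; have : (phi @` A) (phi z) by [exists z]; rewrite phiA/= in_itv.
wlog : phi phiA phi_iso phi01 / phi x = 0 => [W|px0].
  have [px py] := (phi01 _ Ax, phi01 _ Ay).
  have := phi_iso x y; rewrite !inE => /(_ Ax Ay) pxy.
  have [|pxn0] := eqVneq (phi x) 0; first exact: W.
  apply: (W (fun z => mdist x y - phi z)).
  - apply/seteqP; split => [_ [z Az <-]|s /=]; rewrite /= in_itv/=.
      have := phi01 _ Az; lra.
    move=> s01; have : (phi @` A) (mdist x y - s).
      by rewrite phiA/= in_itv/=; lra.
    by move=> [z Az zs]; exists z => //; lra.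
  - move=> u v Au Av; rewrite -(phi_iso _ _ Au Av) [RHS]distrC; congr (`|_|); lra.
  - move=> z /phi01; lra.
  - have : 0 < phi x by rewrite lt_neqAle eq_sym pxn0; case/andP: px.
    by move=> p0; move: pxy; case: (ler0P (phi x - phi y)) => ? ?; lra.
have inv s : exists z, 0 <= s <= mdist x y -> A z /\ phi z = s.
  have [s01|] := pselect (0 <= s <= mdist x y); last by exists x.
  have : (phi @` A) s by rewrite phiA/= in_itv.
  by move=> [z]; exists z.
have [c cP] := choice inv.
have phi_inj u v : A u -> A v -> phi u = phi v -> u = v.
  move=> Au Av uv; apply: mdist_positivity.
  by rewrite -phi_iso ?inE// uv subrr normr0.
exists c; split.
- move=> s t s0 st ta.
  have [|As ps] := cP s; first lra.
  have [|At pt] := cP t; first lra.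
  rewrite -phi_iso ?inE// ps pt ler0_norm; lra.
- by have [|A0 p0] := cP 0; [lra|apply: phi_inj => //; rewrite px0].
- have [|A0 p0] := cP (mdist x y); first lra.
  apply: phi_inj => //; rewrite p0.
  have := phi_iso x y; rewrite !inE => /(_ Ax Ay); rewrite px0 sub0r normrN.
  by rewrite ger0_norm//; have := phi01 _ Ay; lra.
- apply/seteqP; split => [z Az|_ [s /= + <-]].
    have pz := phi01 _ Az; exists (phi z); first by rewrite /= in_itv.
    by have [//|Az' pz'] := cP (phi z); exact: phi_inj.
  by rewrite in_itv/= => /cP[].
Qed.

Lemma rtree_geodesic : geodesic.
Proof.
move=> x y s /andP[s0 sd]; have [c [ci c0 cd _]] := rtree_path x y.
exists (c s).
  by rewrite -[X in mdist X _]c0 ci// subr0.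
by rewrite -[X in mdist _ X]cd ci.
Qed.

Lemma rtree_concat x y c1 c2 a b : 0 <= a -> 0 <= b -> c1 0 = x -> c2 b = y ->
  isopath c1 a -> isopath c2 b -> c1 a = c2 0 ->
  (forall s t, 0 <= s <= a -> 0 <= t <= b -> c1 s = c2 t -> s = a /\ t = 0) ->
  segment x y (c2 0).
Proof.
move=> a0 b0 <- <- c1a c2b c12 cross.
have [ab|] := ltP 0 (a + b); last first.
  move=> ab; have -> : b = 0 by lra.
  rewrite -c12; have -> : a = 0 by lra.
  by left.
have [A [arcA A1 A2]] := arc_concat a0 b0 ab c1a c2b c12 cross.
have [e|ne] := eqVneq (c1 0) (c2 b); last first.
  by rewrite (rtree_segment ne arcA); apply: A2; lra.
by exfalso; have [||p q] := cross 0 b _ _ e; lra.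
Qed.

(** For the inclusion of metric betweenness in segments, the geodesics from x
to z and from z to y can only meet at z, so that they form an arc through z. *)
Lemma rtree_segmentE x y : segment x y = between x y.
Proof.
apply/seteqP; split => z.
  have [c [ci c0 cd ->]] := rtree_path x y => -[s /=].
  rewrite in_itv/= => /andP[s0 sd] <-; rewrite /between/=.
  rewrite -[X in mdist X _ + _]c0 -[X in _ + mdist _ X]cd !ci//; lra.
move=> xzy; rewrite /between/= in xzy.
have [c1 [c1i c10 c1d _]] := rtree_path x z.
have [c2 [c2i c20 c2d _]] := rtree_path z y.
rewrite -c20; apply: (@rtree_concat x y c1 c2 (mdist x z) (mdist z y));
  rewrite ?mdist_ge0 //.
- by rewrite c1d c20.
- move=> s t /andP[s0 sa] /andP[t0 tb] e.
  have /(_ _ _ _)/esym := c1i 0 s; rewrite c10 lexx s0 sa => /(_ _ _ _) h1.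
  have h2 := c2i t (mdist z y) t0 tb (lexx _); rewrite c2d -e in h2.
  have := metric_triangle x (c1 s) y; rewrite -h1 // h2; lra.
Qed.

Lemma rtree_between_mdist x y u v : between x y u -> between x y v ->
  mdist x u <= mdist x v -> mdist u v = mdist x v - mdist x u.
Proof.
rewrite -rtree_segmentE; have [c [ci c0 cd ->]] := rtree_path x y.
move=> [s /=] + <- [t /=] + <-; rewrite !in_itv/= => /andP[s0 sd] /andP[t0 td].
have xc r : 0 <= r -> r <= mdist x y -> mdist x (c r) = r.
  by move=> r0 rd; rewrite -[X in mdist X _]c0 ci// subr0.
by rewrite !xc// => st; rewrite ci.
Qed.

(** The median is the last point of [x, y] that lies on [x, z]: following [y, x]
from y to it, and then [x, z] towards z, is an arc, hence is [y, z]. *)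
Lemma rtree_median x y z :
  exists m, [/\ between x y m, between x z m & between y z m].
Proof.
have [c [ci c0 cd cE]] := rtree_path x y.
pose S : set R := [set s | 0 <= s <= mdist x y /\ between x z (c s)].
have S0 : S 0.
  by rewrite /S/= lexx mdist_ge0 c0 /between/= mdistxx add0r.
have ubS : has_ubound S by exists (mdist x y) => s [/andP[]].
pose s1 := sup S.
have s1P : 0 <= s1 <= mdist x y.
  rewrite (ub_le_sup ubS)//= ge_sup//; first by exists 0.
  by move=> s [/andP[]].
have Ss1 : between x z (c s1).
  apply/eqP; rewrite eq_le; apply/andP; split; last exact: metric_triangle.
  apply/ler_addgt0Pl => e e0.
  have [|s Ss ss1] := @sup_adherent _ S (e / 2) _ (conj (ex_intro _ _ S0) ubS).
    by lra.
  have s_le : s <= s1 by exact: ub_le_sup.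
  have [/andP[s0 sd] bs] := Ss; rewrite /between/= in bs.
  have cs : mdist (c s) (c s1) = s1 - s by apply: ci => //; case/andP: s1P.
  have := metric_triangle x (c s) (c s1).
  have := metric_triangle (c s1) (c s) z.
  rewrite (metric_sym (c s1) (c s)) cs -/s1; move: ss1; rewrite -/s1; lra.
exists (c s1).
have bxy : between x y (c s1).
  rewrite -rtree_segmentE cE; exists s1 => //=; by rewrite in_itv.
split => //; rewrite -rtree_segmentE.
have [s10 s1d] := andP s1P.
have [k [ki k0 kd kE]] := rtree_path (c s1) z.
rewrite -k0.
apply: (@rtree_concat _ _ (fun s => c (mdist x y - s)) k
   (mdist x y - s1) (mdist (c s1) z)); rewrite ?mdist_ge0 //.
- lra.
- by rewrite subr0.
- move=> s t s0 st ta; rewrite metric_sym ci; lra.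
- by rewrite k0; congr c; lra.
- move=> s t /andP[sa sb] /andP[t0 tb] e.
  have bt : between (c s1) z (k t).
    by rewrite -rtree_segmentE kE; exists t => //=; rewrite in_itv/= t0.
  have bz : between x z (k t).
    rewrite /between/= in bt Ss1 *; apply/eqP; rewrite eq_le metric_triangle andbT.
    have := metric_triangle x (c s1) (k t); lra.
  have : S (mdist x y - s) by rewrite /S/= e; split => //; lra.
  move=> /(ub_le_sup ubS); rewrite -/s1 => h.
  have hs : s = mdist x y - s1 by lra.
  split => //.
  move: e; rewrite hs => e.
  have := ki 0 t (lexx _) t0 tb; rewrite k0 -e.
  have -> : mdist x y - (mdist x y - s1) = s1 by lra.
  by rewrite mdistxx; lra.
Qed.

(** The medians of (z, w, x) and of (z, w, y) lie on [z, w]; if the first one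
is closer to z, a path from x to y through it is short enough. *)
Lemma rtree_four_point : four_point.
Proof.
move=> x y z w.
have [m1 [zm1 zxm1 wxm1]] := rtree_median z w x.
have [m2 [zm2 zym2 wym2]] := rtree_median z w y.
wlog m12 : x y m1 m2 zm1 zxm1 wxm1 zm2 zym2 wym2 / mdist z m1 <= mdist z m2.
  move=> W; have [|/ltW] := leP (mdist z m1) (mdist z m2); first exact: W.
  move=> /(W y x m2 m1); rewrite (metric_sym y x) (metric_sym y z).
  rewrite (metric_sym y w) (metric_sym x z) (metric_sym x w).
  by move=> [] // h; [right|left]; move: h; lra.
right; have d12 := rtree_between_mdist zm1 zm2 m12.
have := metric_triangle x m1 y; have := metric_triangle m1 m2 y.
move: zm1 zxm1 wxm1 zm2 zym2 wym2; rewrite /between/= d12.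
by rewrite (metric_sym x m1) (metric_sym x w) (metric_sym y z) (metric_sym m1 w); lra.
Qed.

End from_rtree.
End metric_trees.

(** * R-trees from the four-point condition *)

Lemma sup_closed (R : realType) (A : set R) :
  A !=set0 -> has_ubound A -> closed A -> A (sup A).
Proof. by move=> A0 uA; apply; exact: closure_sup. Qed.

Lemma inf_closed (R : realType) (A : set R) :
  A !=set0 -> has_lbound A -> closed A -> A (inf A).
Proof.
move=> A0 lA cA; apply: cA => U /nbhs_ballP[e /= e0 eU].
have [s As se] := inf_adherent e0 (conj A0 lA).
exists s; split => //; apply: eU; rewrite /ball/= ler0_norm; first lra.
by rewrite subr_le0; exact: ge_inf.
Qed.

Section clamp.
Context (R : realType) (T : topologicalType).

(** The retraction of the line onto the unit interval: composing with it turns continuity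
within the interval into plain continuity. *)
Definition clamp (s : R) : R := (`|s| - `|s - 1| + 1) / 2.

Lemma clamp_id s : 0 <= s <= 1 -> clamp s = s.
Proof.
move=> /andP[s0 s1]; rewrite /clamp ger0_norm// ler0_norm ?subr_le0//; lra.
Qed.

Lemma clamp01 s : 0 <= clamp s <= 1.
Proof.
rewrite /clamp; case: (ler0P s) => ?; case: (ler0P (s - 1)) => ?; lra.
Qed.

Lemma clamp_continuous : continuous clamp.
Proof.
move=> s; apply: cvgM; last exact: cvg_cst.
apply: cvgD; last exact: cvg_cst.
apply: cvgB; first by apply: cvg_norm; exact: cvg_id.
by apply: cvg_norm; apply: cvgB; [exact: cvg_id|exact: cvg_cst].
Qed.

Lemma continuous_clamp (g : R -> T) :
  {within `[0, 1], continuous g} -> continuous (g \o clamp).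
Proof.
move=> /subspace_continuousP cg s.
have s01 : `[0, 1]%classic (clamp s) by rewrite /= in_itv/= clamp01.
apply: (cvg_trans _ (cg _ s01)) => P /= gP.
have gP' : nbhs s [set t | `[0, 1]%classic (clamp t) -> P (g (clamp t))].
  exact: (clamp_continuous gP).
apply: filterS gP' => t /=; apply.
by rewrite /= in_itv/= clamp01.
Qed.

End clamp.

Lemma locally_constant_eq (R : realType) (h : R -> R) (a b : R) : a <= b ->
  continuous h -> (forall s, a < s < b -> \forall t \near s, h t = h s) ->
  h a = h b.
Proof.
rewrite le_eqVlt => /predU1P[->//|ab] ch lh.
have [s||s _] := @MVT _ h (fun=> 0) a b ab.
- rewrite in_itv/= => /lh hs.
  have H : is_derive s (1 : R) (cst (h s)) (0 : R) by exact: is_derive_cst.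
  apply: near_eq_is_derive H.
  by apply: filterS hs => t ->.
- exact: continuous_subspaceT.
- by rewrite mul0r => /eqP; rewrite subr_eq0 => /eqP.
Qed.

Section hyperbolic.
Context (R : realType) (T : metricType R).
Hypothesis fp : four_point T.
Implicit Types x y z w : T.

Lemma mdist_continuous x : continuous (mdist x : T -> R).
Proof.
move=> y; apply/cvgrPdist_lt => e e0; apply/nbhs_distP; exists e => // z yz.
apply: le_lt_trans yz; rewrite ler_norml.
have := metric_triangle x y z; have := metric_triangle x z y.
rewrite (metric_sym z y); lra.
Qed.

(** The Gromov product of y and z at x. In a tree it is the distance from x to
the segment [y, z], and also the position of the projection of z on [x, y]. *)
Definition gromov x y z : R := (mdist x y + mdist x z - mdist y z) / 2.

Lemma gromov_ge0 x y z : 0 <= gromov x y z.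
Proof.
rewrite /gromov; have := metric_triangle y x z; rewrite (metric_sym y x); lra.
Qed.

Lemma between_mdist x y u v : between x y u -> between x y v ->
  mdist x u <= mdist x v -> mdist u v = mdist x v - mdist x u.
Proof.
rewrite /between/= => xu xv uv.
have := fp x y u v; have := metric_triangle x u v; have := metric_triangle u v y.
rewrite (metric_sym y u) (metric_sym y v); lra.
Qed.

(** This is the four-point condition seen from the base point w: the directions
in which points leave w satisfy an ultrametric inequality. *)
Lemma gromov_ultra w x y z :
  gromov w x y <= gromov w x z \/ gromov w y z <= gromov w x z.
Proof.
have := fp w y x z; rewrite /gromov (metric_sym y z) (metric_sym y x); lra.
Qed.

Lemma gromov_gt0_trans w x y z :
  0 < gromov w x y -> 0 < gromov w y z -> 0 < gromov w x z.
Proof. have := gromov_ultra w x y z; lra. Qed.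

(** Off [x, y], moving a point by less than its distance to [x, y] does not
move its projection. *)
Lemma gromov_locally_constant x y z z' : mdist z z' < gromov z x y ->
  gromov x y z' = gromov x y z.
Proof.
rewrite /gromov => h.
have := fp x y z z'; have := fp x z y z'; have := fp x z' y z.
have := metric_triangle x z' z; have := metric_triangle x z z'.
have := metric_triangle y z' z; have := metric_triangle y z z'.
rewrite (metric_sym z y) (metric_sym z' y) (metric_sym z x) (metric_sym z' z) in h *.
by lra.
Qed.

Lemma gromov_continuous x y : continuous (gromov x y : T -> R).
Proof.
move=> z; apply: cvgM; last exact: cvg_cst.
apply: cvgB; last exact: mdist_continuous.
by apply: cvgD; [exact: cvg_cst|exact: mdist_continuous].
Qed.

Lemma gromovC x y z : gromov x y z = gromov x z y.
Proof. by rewrite /gromov (metric_sym y z); ring. Qed.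

Lemma gromov0P z x y : gromov z x y = 0 <-> between x y z.
Proof. by rewrite /gromov /between/= (metric_sym z x); split; lra. Qed.

Lemma between_gromovE x y z : between x y z -> gromov x y z = mdist x z.
Proof. by rewrite /gromov /between/= (metric_sym z y); lra. Qed.

(** An arc that leaves [x, y] does so on an open interval of parameters, between
two points of [x, y]. Along the excursion the projection to [x, y] is locally
constant, hence constant, so that both points coincide, against injectivity. *)
Lemma arc_sub_between x y A : is_arc x y A -> A `<=` between x y.
Proof.
move=> [g [cg gi g0 g1 ->]] _ [s0 /= + <-]; rewrite in_itv/= => s01.
apply: contrapT => /gromov0P/eqP rs0.
pose G := g \o @clamp R.
have GE s : 0 <= s <= 1 -> G s = g s by move=> ?; rewrite /G/= clamp_id.
have cG : continuous G by exact: continuous_clamp.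
(* The distance to [x, y] along the arc. *)
pose rho s := gromov (G s) x y.
have crho : continuous rho.
  move=> s; rewrite /rho /gromov; apply: cvgM; last exact: cvg_cst.
  apply: cvgB; last exact: cvg_cst.
  have cd z : mdist (G t) z @[t --> s] --> mdist (G s) z.
    under eq_fun do rewrite metric_sym.
    rewrite metric_sym; apply: continuous_comp; first exact: cG.
    exact: mdist_continuous.
  by apply: cvgD.
have cZ : closed [set s | rho s = 0].
  exact: (@closed_comp _ _ rho [set 0] (fun s _ => crho s) (@closed_eq _ _)).
have rho0 : rho 0 = 0.
  by apply/gromov0P; rewrite GE ?lexx ?ler01// g0 /between/= mdistxx add0r.
have rho1 : rho 1 = 0.
  by apply/gromov0P; rewrite GE ?lexx ?ler01// g1 /between/= mdistxx addr0.
have [s00 s01'] := andP s01.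
pose S1 := [set s | rho s = 0] `&` [set s | s <= s0].
pose S2 := [set s | rho s = 0] `&` [set s | s0 <= s].
have uS1 : has_ubound S1 by exists s0 => s [].
have lS2 : has_lbound S2 by exists s0 => s [].
have [ra a_le] : S1 (sup S1).
  apply: sup_closed => //; first by exists 0.
  by apply: closedI => //; exact: closed_le.
have [rb b_ge] : S2 (inf S2).
  apply: inf_closed => //; first by exists 1.
  by apply: closedI => //; exact: closed_ge.
set a := sup S1 in ra a_le *; set b := inf S2 in rb b_ge *.
rewrite /= in ra a_le rb b_ge.
have a0 : 0 <= a by exact: (ub_le_sup uS1 (conj rho0 s00)).
have b1 : b <= 1 by exact: (ge_inf lS2 (conj rho1 s01')).
have rs0' : rho s0 != 0 by rewrite /rho GE.
have as0 : a < s0.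
  by rewrite lt_neqAle a_le andbT; apply: contraNneq rs0' => <-; apply/eqP.
have s0b : s0 < b.
  by rewrite lt_neqAle b_ge andbT; apply: contraNneq rs0' => ->; apply/eqP.
have rho_gt0 s : a < s < b -> 0 < rho s.
  move=> /andP[sa sb]; rewrite lt_neqAle (gromov_ge0 _ _ _ : 0 <= rho s) andbT eq_sym.
  apply/eqP => rs; have [ss0|/ltW ss0] := leP s s0.
    by have : s <= a; [exact: (ub_le_sup uS1 (conj rs ss0))|lra].
  by have : b <= s; [exact: (ge_inf lS2 (conj rs ss0))|lra].
have tab : gromov x y (G a) = gromov x y (G b).
  apply: (@locally_constant_eq _ (fun s => gromov x y (G s))); first by lra.
    move=> s; apply: (@continuous_comp _ _ _ G (gromov x y)); first exact: cG.
    exact: gromov_continuous.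
  move=> s /rho_gt0 rs.
  have Gs := cG s; have /(Gs _) : nbhs (G s) [set z | mdist (G s) z < rho s].
    by apply/nbhs_distP; exists (rho s).
  move=> Gs'; apply: (@filterS _ (nbhs s) _ _ _ _ Gs') => u /= h.
  exact: gromov_locally_constant.
move/gromov0P : ra => ra; move/gromov0P : rb => rb.
rewrite !between_gromovE// in tab.
have Gab : G a = G b.
  apply: mdist_positivity; rewrite (between_mdist ra rb) ?tab ?lexx//.
  by rewrite subrr.
have := gi a b; rewrite !in_itv/= => /(_ _ _ _); rewrite !GE in Gab; try lra.
by move=> /(_ _ _ Gab) h; have : a = b by [apply: h; lra]; lra.
Qed.

Lemma between_arc (geo : geodesic T) x y : x != y -> is_arc x y (between x y).
Proof.
move=> xy; have d0 : 0 < mdist x y by rewrite mdist_gt0.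
have ex s : exists z, 0 <= s <= mdist x y -> mdist x z = s /\ mdist z y = mdist x y - s.
  have [sd|] := pselect (0 <= s <= mdist x y); last by exists x.
  by have [z h1 h2] := geo _ _ _ sd; exists z.
have [c cP] := choice ex.
pose g u := c (u * mdist x y).
have u01 u : 0 <= u <= 1 -> 0 <= u * mdist x y <= mdist x y.
  by move=> /andP[u0 u1]; rewrite mulr_ge0//= ?ler_piMl// ltW.
have gb u : 0 <= u <= 1 -> between x y (g u).
  by move=> /u01/cP[h1 h2]; rewrite /between/= h1 h2; lra.
have xg u : 0 <= u <= 1 -> mdist x (g u) = u * mdist x y.
  by move=> /u01/cP[].
have i01 : 0 <= (0 : R) <= 1 by lra.
have i11 : 0 <= (1 : R) <= 1 by lra.
have g0 : g 0 = x by apply/esym/mdist_positivity; rewrite xg ?mul0r.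
have g1 : g 1 = y.
  apply: mdist_positivity; have := gb _ i11; rewrite /between/= xg//; lra.
have -> : between x y = g @` `[0, 1].
  apply/seteqP; split => [z xzy|_ [u /= + <-]]; last first.
    by rewrite in_itv/=; exact: gb.
  have xz : 0 <= mdist x z / mdist x y <= 1.
    rewrite divr_ge0 ?mdist_ge0//= ler_pdivrMr// mul1r.
    by move: xzy; rewrite /between/=; have := mdist_ge0 z y; lra.
  exists (mdist x z / mdist x y); first by rewrite /= in_itv.
  apply: mdist_positivity.
  have xgz : mdist x (g (mdist x z / mdist x y)) = mdist x z.
    by rewrite xg// divfK// gt_eqF.
  by rewrite (between_mdist (gb _ xz) xzy) xgz ?subrr.
rewrite -[X in is_arc X]g0 -[X in is_arc _ X]g1.
apply: (@lipschitz_arc _ _ _ (mdist x y)).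
  move=> s t s0 st t1.
  have s01 : 0 <= s <= 1 by lra.
  have t01 : 0 <= t <= 1 by lra.
  rewrite (between_mdist (gb _ s01) (gb _ t01)) !xg//; first by lra.
  by rewrite ler_wpM2r// ltW.
move=> s t; rewrite !in_itv/= => s01 t01 st.
by apply: (mulIf (lt0r_neq0 d0)); rewrite -!xg// st.
Qed.

(** An arc from x to y stays in [x, y], and by the intermediate value theorem it
meets every point of [x, y]; so it is [x, y]. *)
Lemma four_point_rtree : geodesic T -> rtree T.
Proof.
move=> geo x y xy; exists (between x y); split; first exact: between_arc.
  move=> B xyB; apply/seteqP; split; first exact: arc_sub_between.
  move=> z xyz; have := arc_sub_between xyB.
  have [g [cg gi g0 g1 ->]] := xyB => gb.
  pose G := g \o @clamp R.
  have GE s : 0 <= s <= 1 -> G s = g s by move=> ?; rewrite /G/= clamp_id.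
  have cG : continuous G by exact: continuous_clamp.
  have [|||s] := @IVT _ (fun s => mdist x (G s)) 0 1 (mdist x z).
  - exact: ler01.
  - apply: continuous_subspaceT => s.
    by apply: (@continuous_comp _ _ _ G (mdist x)); [exact: cG|exact: mdist_continuous].
  - rewrite !GE ?lexx ?ler01// g0 g1 mdistxx.
    rewrite min_l ?mdist_ge0// max_r ?mdist_ge0//=.
    by move: xyz; rewrite /between/=; have := mdist_ge0 z y; lra.
  - rewrite in_itv/= => s01; rewrite GE// => xgs.
    have gs : (g @` `[0, 1]) (g s) by exists s => //; rewrite /= in_itv.
    suff -> : z = g s by [].
    apply/esym/mdist_positivity.
    by rewrite (between_mdist (gb _ gs) xyz) ?xgs// subrr.
exists (mdist x); split.
  apply/seteqP; split => [_ [z xyz <-]|s].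
    rewrite /= in_itv/= mdist_ge0/=.
    by move: xyz; rewrite /between/=; have := mdist_ge0 z y; lra.
  rewrite /= in_itv/= => /geo[z xz zy]; exists z => //.
  by rewrite /between/= xz zy; lra.
move=> u v; rewrite !inE => xyu xyv.
have [uv|/ltW uv] := leP (mdist x u) (mdist x v).
  rewrite (between_mdist xyu xyv)// ler0_norm ?subr_le0//; lra.
by rewrite (metric_sym u v) (between_mdist xyv xyu)// ger0_norm ?subr_ge0.
Qed.

End hyperbolic.

(** * Convex hulls and branching points *)

Section convex_hull.
Context (R : realType) (T : metricType R).
Hypothesis tT : rtree T.
Implicit Types x y z w p q r : T.

Let fp := rtree_four_point tT.
Let segE := rtree_segmentE tT.

Lemma between_sym x y z : between x y z -> between y x z.
Proof.
by rewrite /between/= (metric_sym y z) (metric_sym y x) (metric_sym z x); lra.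
Qed.

Lemma between_trans p y x z : between p y x -> between x y z ->
  [/\ between p y z, between p z x & mdist p z = mdist p x + mdist x z].
Proof.
rewrite /between/=; have := metric_triangle p x z; have := metric_triangle p z y.
by move=> *; split; lra.
Qed.

Section rconv.
Variable M0 : set T.
Let C := rconv M0.

Lemma rconvE z : C z <-> exists x y, [/\ M0 x, M0 y & between x y z].
Proof. by split => -[x [y [Mx My]]]; rewrite ?segE => h; exists x, y; rewrite ?segE. Qed.

Lemma sub_rconv : M0 `<=` C.
Proof. by move=> x Mx; exists x, x; split => //; left. Qed.

(** If x is on [p, p'] then p and p' lie in different directions from x, so y is
in a direction other than that of p or than that of p'. *)
Lemma rconv_extend x y : C x -> exists2 p, M0 p & between p y x.
Proof.
move=> /rconvE[p [p' [Mp Mp' ppx]]].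
have := gromov_ultra fp x p y p'; move/gromov0P : ppx => ->.
have := gromov_ge0 x p y; have := gromov_ge0 x y p'.
move=> h1 h2 [h3|h3]; [exists p|exists p'] => //; apply/gromov0P.
  lra.
by rewrite gromovC; lra.
Qed.

(** This prolongs the segment [x, y] of the hull to a segment [p, q] whose ends
are points of M0, which reduces null sets to segments of that kind. *)
Lemma rconv_extend2 x y : C x -> C y ->
  exists p q, [/\ M0 p, M0 q, between p q y & between p y x].
Proof.
move=> Cx Cy; have [p Mp pyx] := rconv_extend y Cx.
have [q Mq qpy] := rconv_extend p Cy.
by exists p, q; split => //; exact: between_sym.
Qed.

Lemma rconv_convex x y : C x -> C y -> between x y `<=` C.
Proof.
move=> Cx Cy z xyz; have [p [q [Mp Mq pqy pyx]]] := rconv_extend2 Cx Cy.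
apply/rconvE; exists p, q; split => //.
have [pyz _ _] := between_trans pyx xyz.
by apply: between_sym; have [] := between_trans (between_sym pqy) (between_sym pyz).
Qed.

Lemma between_connected x y : connected (between x y).
Proof.
have [<-|xy] := eqVneq x y.
  by rewrite -segE segmentxx; exact: connected1.
have [g [cg _ _ _ ->]] := between_arc fp (rtree_geodesic tT) xy.
apply: connected_continuous_connected => //.
exact: segment_connected.
Qed.

Lemma same_component w y y' : C y -> C y' -> ~ between y y' w ->
  connected_component (C `\ w) y = connected_component (C `\ w) y'.
Proof.
move=> Cy Cy' nw; apply: same_connected_component.
exists (between y y'); last by rewrite /between/= mdistxx addr0.
split; [by rewrite /between/= mdistxx add0r| |exact: between_connected].
move=> z yz; split; first exact: rconv_convex yz.
by move=> zw; apply: nw; rewrite -zw.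
Qed.

(** The points in the same direction from w as y form a set that is open and is
closed off w. *)
Lemma distinct_components w y y' : C y -> y <> w -> y' <> w ->
  between y y' w ->
  connected_component (C `\ w) y <> connected_component (C `\ w) y'.
Proof.
move=> Cy yw y'w yy'w E.
pose A := [set z | 0 < gromov w y z].
pose K := connected_component (C `\ w) y.
have KC : K `<=` C `\ w := @connected_component_sub _ _ _.
have Ky : K y by apply: connected_component_refl; split.
have Ky' : K y'.
  have [Cy'|Cy'] := pselect (C y').
    by rewrite /K E; apply: connected_component_refl; split.
  by move: Ky; rewrite /K E connected_component_out// => -[].
have oA : open A.
  apply: (@open_comp _ _ (gromov w y) [set t | 0 < t]); last exact: open_gt.
  by move=> z _; exact: gromov_continuous.
have KA : K `&` A = K.
  apply: (@component_connected _ (C `\ w) y (K `&` A)).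
  - exists y; split => //; rewrite /A/= /gromov mdistxx.
    have : 0 < mdist w y by rewrite mdist_gt0; apply/eqP => e; apply: yw.
    lra.
  - by exists A.
  - exists (closure A); first exact: closed_closure.
    apply/seteqP; split => z [Kz Az]; split => //; first exact: subset_closure.
    have wz : 0 < mdist w z by rewrite mdist_gt0 eq_sym; apply/eqP; case: (KC _ Kz).
    have [|u [Au zu]] := Az [set u | mdist z u < mdist w z].
      by apply/nbhs_distP; exists (mdist w z).
    apply: (gromov_gt0_trans fp Au); rewrite /gromov.
    have := mdist_ge0 w u; rewrite /= metric_sym in zu; lra.
have : (K `&` A) y' by rewrite KA.
by move=> [_]; rewrite /A/=; move/gromov0P : yy'w => ->; rewrite ltxx.
Qed.

Lemma branching_intro w (y : nat -> T) : C w ->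
  (forall i, (i < 3)%N -> C (y i) /\ y i <> w) ->
  (forall i j, (i < 3)%N -> (j < 3)%N -> i != j -> between (y i) (y j) w) ->
  branching C w.
Proof.
move=> Cw yC yw; split => //; apply/pcard_leP/injfunPex.
exists (fun i => connected_component (C `\ w) (y i)).
  by move=> i /= i3; exists (y i) => //; exact: yC.
move=> i j; rewrite !inE/= => i3 j3 e; apply: contrapT => /eqP ij.
have [Ci iw] := yC _ i3; have [_ jw] := yC _ j3.
exact: (distinct_components Ci iw jw (yw _ _ i3 j3 ij)).
Qed.

(** Among three directions at [w], at least one is neither that of [p] nor that of
[q]; a point of [M0] in that direction is separated from both by [w]. *)
Lemma branching_project w p q : branching C w ->
  exists2 r, M0 r & between p r w /\ between q r w.
Proof.
move=> [Cw /pcard_leP/injfunPex[f fS fI]].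
have ex i : exists y, (i < 3)%N ->
   (C `\ w) y /\ connected_component (C `\ w) y = f i.
  by have [/fS[y Cy yi]|_] := ltnP i 3; [exists y|exists w].
have [y yP] := choice ex.
have far i j : (i < 3)%N -> (j < 3)%N -> i != j -> gromov w (y i) (y j) = 0.
  move=> i3 j3 ij; apply/gromov0P; apply: contrapT => nw.
  have [[Cyi _] ei] := yP _ i3; have [[Cyj _] ej] := yP _ j3.
  have := same_component Cyi Cyj nw; rewrite ei ej => /fI; rewrite !inE => /(_ i3 j3) e.
  by rewrite e eqxx in ij.
(* At most one of the three directions is that of p, and at most one that of q. *)
have [i [i3 pi qi]] : exists i, [/\ (i < 3)%N, gromov w p (y i) = 0 &
    gromov w q (y i) = 0].
  have u i j z : (i < 3)%N -> (j < 3)%N -> i != j ->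
      gromov w z (y i) = 0 \/ gromov w z (y j) = 0.
    move=> i3 j3 ij; have := far i j i3 j3 ij.
    have := gromov_gt0_trans fp (w := w) (x := y i) (y := z) (z := y j).
    rewrite (gromovC w (y i)) => h1 h2.
    have := gromov_ge0 w z (y i); have := gromov_ge0 w z (y j).
    rewrite !le_eqVlt => /predU1P[<-|h3]; first by right.
    move=> /predU1P[<-|h4]; first by left.
    by have := h1 h4 h3; rewrite h2 ltxx.
  have := (u 0 1 p isT isT isT, u 0 2 p isT isT isT, u 1 2 p isT isT isT)%N.
  have := (u 0 1 q isT isT isT, u 0 2 q isT isT isT, u 1 2 q isT isT isT)%N.
  move=> [[[h1|h1] [h2|h2]] [h3|h3]] [[[k1|k1] [k2|k2]] [k3|k3]];
  by [exists 0%N|exists 1%N|exists 2%N].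
have [[Cyi yiw] _] := yP _ i3.
have [r Mr rwy] := rconv_extend w Cyi.
have ryi : 0 < gromov w r (y i).
  have wy : 0 < mdist w (y i).
    by rewrite mdist_gt0; apply/eqP => e; apply: yiw.
  move: rwy; rewrite /between/= /gromov (metric_sym w r) (metric_sym w (y i)).
  by rewrite (metric_sym w (y i)) in wy; lra.
have sep z : gromov w z (y i) = 0 -> between z r w.
  move=> zy; apply/gromov0P; apply/eqP; rewrite eq_le gromov_ge0 andbT leNgt.
  by apply/negP => zr; have := gromov_gt0_trans fp zr ryi; rewrite zy ltxx.
by exists r => //; split; exact: sep.
Qed.

End rconv.
End convex_hull.

(** * Norms of combinations of evaluations *)

Section molecules.
Context (R : realType) (M : metricType R) (o : M).

Lemma lip0_subproof (f : M -> R) k :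
  (forall x y, `|f x - f y| <= k * mdist x y) ->
  (fun x => f x - f o) \in @lipschitz0 R M o.
Proof.
move=> fk; apply/asboolP; split; first by rewrite subrr.
by exists k => x y; rewrite opprB addrA subrK.
Qed.

Definition mklip0 f k fk : lip0 o := Lip0 (@lip0_subproof f k fk).

Lemma mklip0_norm f k fk : 0 <= k -> `|@mklip0 f k fk| <= k.
Proof.
by move=> k0; apply: lip0_norm_le => // x y /=; rewrite opprB addrA subrK.
Qed.

Lemma lipfree_delta_subproof x : delta o x \in @lipfree_pred R M o.
Proof.
apply/mem_set/subset_closure; exists 1%N, (fun=> 1), (fun=> x).
by rewrite big_ord1 scale1r.
Qed.

Definition ldelta x : lipfree o := Lipfree (lipfree_delta_subproof x).

Lemma lipfree_norm_ge (u : lipfree o) (f : lip0 o) :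
  `|f| <= 1 -> `|lipfree_val u f| <= `|u|.
Proof. by move=> f1; exact: dual_norm_ge. Qed.

Lemma lipfree_norm_le (u : lipfree o) k :
  (forall f : lip0 o, `|f| <= 1 -> `|lipfree_val u f| <= k) -> `|u| <= k.
Proof. by move=> h; exact: dual_norm_le. Qed.

Lemma molecule_norm_le x y : `|ldelta x - ldelta y| <= mdist x y.
Proof.
apply: lipfree_norm_le => f f1.
have -> : lipfree_val (ldelta x - ldelta y) f = f x - f y by [].
by apply: (le_trans (lip0_normP f x y)); rewrite ler_piMl// mdist_ge0.
Qed.

(** When the pairing of x with z and of y with w is a cheapest transport, duality
gives a 1-Lipschitz function that attains both distances; here it is explicit. *)
Lemma molecule_pair_norm x z y w :
  mdist x z + mdist y w <= mdist x w + mdist y z ->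
  `|(ldelta x - ldelta z) + (ldelta y - ldelta w)| = mdist x z + mdist y w.
Proof.
move=> opt; apply/le_anti/andP; split.
  by apply: (le_trans (ler_normD _ _)); rewrite lerD// molecule_norm_le.
(* The value c at w is the least one for which f x = d(x, z). *)
pose c := mdist x z - mdist x w.
pose f u := Num.min (mdist u z) (mdist u w + c).
have fk u v : `|f u - f v| <= 1 * mdist u v.
  rewrite mul1r ler_norml /f.
  have := metric_triangle u v z; have := metric_triangle u v w.
  have := metric_triangle v u z; have := metric_triangle v u w.
  rewrite (metric_sym v u) !minEle; do 2 case: ifPn; rewrite -?ltNge; lra.
have := lipfree_norm_ge ((ldelta x - ldelta z) + (ldelta y - ldelta w))
  (mklip0_norm (k := 1) fk ler01).
set v := lipfree_val _ _; have -> : v = (f x - f o - (f z - f o)) + (f y - f o - (f w - f o)) by [].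
apply: le_trans; apply: le_trans (ler_norm _).
have -> : f x = mdist x z by rewrite /f min_l// /c; lra.
have -> : f z = 0.
  rewrite /f min_l mdistxx// /c; have := metric_triangle x z w; lra.
have -> : f w = c.
  rewrite /f min_r mdistxx ?add0r// /c.
  by have := metric_triangle x w z; lra.
have -> : f y = mdist y w + c by rewrite /f min_r// /c; lra.
lra.
Qed.

Lemma molecule_norm x y : `|ldelta x - ldelta y| = mdist x y.
Proof.
have := @molecule_pair_norm x y x x; rewrite subrr addr0 mdistxx addr0; apply.
by rewrite add0r.
Qed.

End molecules.

Section ell1.
Context (R : realType) (I : choiceType).
Implicit Types u v : ell1 R I.

(** Inequalities that hold in each coordinate can be summed; the extra term c
records what is gained on finitely many coordinates. *)
Lemma ell1_le (u v u' v' : ell1 R I) (F : set I) (c : I -> R) :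
  finite_set F -> (forall i, 0 <= c i) ->
  (forall i, `|u i| + `|v i| + (if i \in F then c i else 0) <= `|u' i| + `|v' i|) ->
  `|u| + `|v| + \sum_(i \in F) c i <= `|u'| + `|v'|.
Proof.
move=> finF c0 h; rewrite -lee_fin !EFinD.
have -> : ((\sum_(i \in F) c i)%:E = \esum_(i in [set: I]) (if i \in F then c i else 0)%:E)%E.
  rewrite -fsumEFin//.
  rewrite -esum_fset//; last by move=> i _; rewrite lee_fin.
  by rewrite esum_mkcond; apply: eq_esum => i _; case: ifP.
have N (w : ell1 R I) : `|w|%:E = \esum_(i in [set: I]) `|w i|%:E.
  exact: ell1_normE.
rewrite !N -!esumD.
  by apply: le_esum => i _; rewrite -!EFinD lee_fin.
all: by move=> i _; rewrite -?EFinD lee_fin ?addr_ge0//; case: ifP.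
Qed.

(** Equality in the triangle inequality of ell1 forces equality in each
coordinate. *)
Lemma ell1_aligned u v i : `|u + v| = `|u| + `|v| -> 0 <= u i * v i.
Proof.
move=> uv; rewrite leNgt; apply/negP => lt0.
(* Apply [ell1_le] with the defect c of the coordinate i as the gain. *)
have [c cE] : exists c : R, c = `|u i| + `|v i| - `|u i + v i| by eexists.
have c0 : 0 < c.
  move: lt0; rewrite cE.
  case: (ler0P (u i)) => hu; case: (ler0P (v i)) => hv;
  case: (ler0P (u i + v i)) => huv; nra.
have h : `|u + v| + `|0 : ell1 R I| + \sum_(j \in [set i]) c <= `|u| + `|v|.
  apply: ell1_le => // [|j]; first by move=> _; exact: ltW.
  rewrite normr0 addr0 [(u + v) j](_ : _ = u j + v j)//.
  case: ifPn; last by rewrite addr0 ler_normD.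
  by rewrite inE => ->; rewrite cE; lra.
by move: h; rewrite normr0 fsbig_set1 uv; lra.
Qed.

End ell1.

(** * Coordinates of an embedding into ell1 are non-crossing cuts *)

Section cuts.
Context (R : realType) (M : metricType R) (o : M) (I : choiceType).
Variable J : {linear lipfree o -> ell1 R I}.
Hypothesis Jiso : forall u, `|J u| = `|u|.
Implicit Types (x y z w p q r : M) (i : I).

Definition coord x i : R := J (ldelta o x) i.

Lemma coordB x y i : (J (ldelta o x - ldelta o y)) i = coord x i - coord y i.
Proof. by rewrite linearB. Qed.

Lemma coord_aligned x z y w i :
  mdist x z + mdist y w <= mdist x w + mdist y z ->
  0 <= (coord x i - coord z i) * (coord y i - coord w i).
Proof.
move=> opt; rewrite -!coordB; apply: ell1_aligned.
by rewrite -linearD !Jiso molecule_pair_norm// !molecule_norm.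
Qed.

(** With z = w, [coord_aligned] shows that none of the three
values lies strictly between the other two. *)
Lemma coord_two_values x y z i :
  [\/ coord x i = coord y i, coord x i = coord z i | coord y i = coord z i].
Proof.
have al u v w : 0 <= (coord u i - coord w i) * (coord v i - coord w i).
  by apply: coord_aligned.
have h1 := al x y z; have h2 := al x z y; have h3 := al y z x.
have [/eqP|xy] := eqVneq (coord x i) (coord y i); first by move/eqP; constructor 1.
have [/eqP|xz] := eqVneq (coord x i) (coord z i); first by move/eqP; constructor 2.
have [/eqP|yz] := eqVneq (coord y i) (coord z i); first by move/eqP; constructor 3.
exfalso.
wlog xy' : x y xy xz yz h1 h2 h3 / coord x i < coord y i.
  move=> W; have := xy; rewrite neq_lt => /orP[|h]; first exact: W.
  by apply: (W y x) => //; rewrite 1?eq_sym// mulrC.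
have /orP[xz'|xz'] : (coord x i < coord z i) || (coord z i < coord x i) by rewrite -neq_lt.
  have /orP[yz'|yz'] : (coord y i < coord z i) || (coord z i < coord y i) by rewrite -neq_lt.
    nra.
  nra.
nra.
Qed.

(** If a pairing is the cheapest of the three, then it remains so when the ends of
one of its pairs are swapped; this reverses one sign in [coord_aligned]. *)
Lemma coord_cross x z y w i :
  mdist x z + mdist y w <= mdist x w + mdist y z ->
  mdist x z + mdist y w <= mdist x y + mdist z w ->
  coord x i = coord z i \/ coord y i = coord w i.
Proof.
move=> h1 h2; have a1 := coord_aligned i h1.
have a2 : 0 <= (coord x i - coord z i) * (coord w i - coord y i).
  apply: coord_aligned; rewrite (metric_sym w y) (metric_sym w z); lra.
have : (coord x i - coord z i) * (coord y i - coord w i) = 0 by nra.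
move/eqP; rewrite mulf_eq0 !subr_eq0 => /orP[/eqP|/eqP]; by [left|right].
Qed.

Lemma coord_sum (x y z w x' y' z' w' : M) (F : set I) (c : I -> R) :
  finite_set F -> (forall i, 0 <= c i) ->
  (forall i, `|coord x i - coord y i| + `|coord z i - coord w i| +
     (if i \in F then c i else 0) <=
     `|coord x' i - coord y' i| + `|coord z' i - coord w' i|) ->
  mdist x y + mdist z w + \sum_(i \in F) c i <= mdist x' y' + mdist z' w'.
Proof.
move=> finF c0 h; rewrite -!(molecule_norm o) -!Jiso; apply: ell1_le => // i.
by rewrite !coordB.
Qed.

(** By [coord_cross], in each coordinate the cheapest pairing has a null term,
and then the two other pairings have the same sum. *)
Lemma coord_four_point : four_point M.
Proof.
have W x y z w : mdist x z + mdist y w <= mdist x w + mdist y z ->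
    mdist x z + mdist y w <= mdist x y + mdist z w ->
    mdist x y + mdist z w <= mdist x w + mdist y z.
  move=> h1 h2; suff : mdist x y + mdist z w + \sum_(i \in (set0 : set I)) (0 : R)
      <= mdist x w + mdist y z by rewrite fsbig_set0 addr0.
  apply: coord_sum => // i; rewrite in_set0 addr0.
  by have [->|->] := coord_cross i h1 h2; rewrite // (distrC (coord z i)) addrC.
move=> x y z w.
have /orP[h1|h1] := le_total (mdist x y + mdist z w) (mdist x z + mdist y w).
  by left.
have /orP[h2|h2] := le_total (mdist x y + mdist z w) (mdist x w + mdist y z).
  by right.
have /orP[h3|h3] := le_total (mdist x z + mdist y w) (mdist x w + mdist y z).
  by right; apply: W => //; lra.
by left; rewrite (metric_sym z w); apply: W; rewrite // ?(metric_sym w z); lra.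
Qed.

(** Among the cuts separating p from q, i puts r on the side of p and r' on the
side of q, while j does the opposite: each of the three pairings is crossed by i
or by j, so none can be the cheapest. *)
Lemma coord_nested p q r r' i j :
  coord p i <> coord q i -> coord r i = coord p i -> coord r' i = coord q i ->
  coord p j <> coord q j -> coord r j = coord q j -> coord r' j = coord p j ->
  False.
Proof.
move=> pqi ri r'i pqj rj r'j.
have cr x z y w k : mdist x z + mdist y w <= mdist x w + mdist y z ->
  mdist x z + mdist y w <= mdist x y + mdist z w ->
  coord x k <> coord z k -> coord y k <> coord w k -> False.
  by move=> h1 h2; have [] := coord_cross k h1 h2.
have /orP[h1|h1] := le_total (mdist p q + mdist r r') (mdist p r + mdist q r').
  have /orP[h2|h2] := le_total (mdist p q + mdist r r') (mdist p r' + mdist q r).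
    by apply: (cr p q r r' i); rewrite ?ri ?r'i// (metric_sym r q).
  apply: (cr p r' q r i); rewrite ?ri ?r'i//.
  - lra.
  - by rewrite (metric_sym r' r); lra.
  - by move=> e; apply: pqi.
have /orP[h2|h2] := le_total (mdist p r + mdist q r') (mdist p r' + mdist q r).
  by apply: (cr p r q r' j); rewrite ?rj ?r'j// => e; apply: pqj.
apply: (cr p r' q r i); rewrite ?ri ?r'i//.
- by rewrite (metric_sym r' r); lra.
- by move=> e; apply: pqi.
Qed.

(** The cuts of F separate r from r', so by [coord_nested] every other cut that
separates p from q either keeps r and r' together or also has r on the side of
p. The bound then holds coordinate by coordinate. *)
Lemma gap_length p q r r' (F : set I) : finite_set F -> F !=set0 ->
  (forall i, F i -> [/\ coord p i <> coord q i, coord r i = coord p i &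
     coord r' i = coord q i]) ->
  gromov p q r + \sum_(i \in F) `|coord p i - coord q i| <= gromov p q r'.
Proof.
move=> finF [i0 Fi0] hF.
suff : mdist q r' + mdist p r + \sum_(i \in F) (2 * `|coord p i - coord q i|)
    <= mdist p r' + mdist q r.
  by rewrite -mulr_fsumr; rewrite /gromov; lra.
apply: coord_sum => // i.
case: ifPn => [|nF].
  rewrite inE => /hF[pqi -> ->]; rewrite !subrr !normr0 (distrC (coord q i)); lra.
rewrite addr0.
have [e|/eqP pqi] := eqVneq (coord p i) (coord q i).
  by rewrite e.
have two z : coord z i = coord p i \/ coord z i = coord q i.
  by have [e|e|e] := coord_two_values p q z i; [case: pqi|left|right].
have [-> | rq] := two r.
  rewrite subrr normr0 addr0.
  by have [-> | ->] := two r'; rewrite !subrr !normr0 ?add0r ?addr0 distrC //; rewrite addr_ge0.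
have [r'p | -> ] := two r'; last by rewrite rq subrr normr0 add0r addr0.
by exfalso; have [pq0 r0 r'0] := hF _ Fi0; exact: (coord_nested pq0 r0 r'0 pqi rq r'p).
Qed.

End cuts.

(** * Null sets of the line and families of gaps *)

Section real_null_sets.
Context (R : realType).
Local Notation mu := (@lebesgue_measure R).

Lemma negligible_completed (N : set R) : mu.-negligible N ->
  lebesgue_measurable N /\ completed_lebesgue_measure N = 0%E.
Proof.
move=> nN; split; last exact/negligible_outer_measure.
apply: negligible_sub_caratheodory; case: nN => B [mB B0 NB].
by exists B; split => //; exact: sub_caratheodory.
Qed.

Lemma completed_negligible (N : set R) :
  completed_lebesgue_measure N = 0%E -> mu.-negligible N.
Proof. by move=> h; apply/negligible_outer_measure. Qed.

(** The first interval splits the others into those on its left and those on its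
right. *)
Lemma increments_le (I : eqType) (a b : I -> R) (g : R -> R) (s : seq I) l u :
  l <= u -> {in `[l, u] &, {homo g : x y / x <= y}} -> uniq s ->
  (forall i, i \in s -> [/\ l <= a i, a i <= b i & b i <= u]) ->
  (forall i j, i \in s -> j \in s -> i != j -> b i <= a j \/ b j <= a i) ->
  \sum_(i <- s) (g (b i) - g (a i)) <= g u - g l.
Proof.
have [n] := ubnP (size s); elim: n s l u => // n IHn [|i s] l u /=.
  by move=> _ lu hg _ _ _; rewrite big_nil subr_ge0 hg// in_itv/= lexx lu.
move=> sn lu hg /andP[nis us] ab dis.
have [li abi bu] := ab i (mem_head _ _).
have sub j : j \in s -> j \in i :: s by rewrite inE => ->; rewrite orbT.
have hgs l' u' : l <= l' -> u' <= u -> {in `[l', u'] &, {homo g : x y / x <= y}}.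
  move=> ll' uu' x y; rewrite !in_itv/= => /andP[h1 h2] /andP[h3 h4].
  by apply: hg; rewrite in_itv/=; lra.
rewrite big_cons (bigID (fun j => b j <= a i))/=.
rewrite -(big_filter s (fun j => b j <= a i)) -(big_filter s (fun j => ~~ (b j <= a i))).
have h1 : \sum_(j <- [seq j <- s | b j <= a i]) (g (b j) - g (a j)) <= g (a i) - g l.
  apply: IHn => //; rewrite ?filter_uniq//.
  - by rewrite (leq_ltn_trans _ (sn : (size s < n)%N))// size_filter count_size.
  - by apply: hgs; lra.
  - by move=> j; rewrite mem_filter => /andP[bj /sub/ab[? ? ?]]; split.
  - move=> j k; rewrite !mem_filter => /andP[_ /sub js] /andP[_ /sub ks].
    exact: dis.
have h2 : \sum_(j <- [seq j <- s | ~~ (b j <= a i)]) (g (b j) - g (a j)) <= g u - g (b i).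
  apply: IHn => //; rewrite ?filter_uniq//.
  - by rewrite (leq_ltn_trans _ (sn : (size s < n)%N))// size_filter count_size.
  - by apply: hgs; lra.
  - move=> j; rewrite mem_filter -ltNge => /andP[bj js].
    have [? ? ?] := ab j (sub j js); split => //.
    have ij : i != j by apply: contraNneq nis => ->.
    by have [] := dis i j (mem_head _ _) (sub j js) ij => //; lra.
  - move=> j k; rewrite !mem_filter => /andP[_ /sub js] /andP[_ /sub ks].
    exact: dis.
lra.
Qed.

(** Each set B i cuts the values of t at a gap, the interval between the values
outside and those inside B i. At a given point, the gaps that contain it all come
from the same cut and have total weight at most their common length; so the sum of
the indicators of the gaps of F, with densities w i over length, is at most 1 off
the closure of the values. Integrating, what this closure leaves free has length
at least the sum of the weights over F, which is almost t q - t p. *)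
Lemma gaps_negligible (M : Type) (I : choiceType) (t : M -> R) (p q : M) (S : set I)
    (w : I -> R) (B : I -> set M) :
  (forall r, t p <= t r <= t q) ->
  (forall i, S i -> [/\ 0 < w i, ~ B i p & B i q]) ->
  (forall (F : set I) r r', finite_set F -> F !=set0 -> F `<=` S ->
     (forall i, F i -> ~ B i r /\ B i r') -> t r + \sum_(i \in F) w i <= t r') ->
  (forall e, 0 < e -> exists F : set I, [/\ finite_set F, F `<=` S &
     t q - t p <= \sum_(i \in F) w i + e]) ->
  mu.-negligible (closure (range t)).
Proof.
move=> tpq SB gapF approx.
pose K := closure (range t); pose D : set R := `[t p, t q]%classic.
have cK : closed K by exact: closed_closure.
have mK : measurable K by exact: closed_measurable.
have mD : measurable D by exact: measurable_itv.
have KD : K `<=` D.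
  rewrite [D](closure_id _).1; last exact: itv_closed.
  by apply: closureS => _ [r _ <-]; rewrite /D/= in_itv/= tpq.
pose a i := sup (t @` (~` B i)); pose b i := inf (t @` (B i)).
have below i r : S i -> ~ B i r -> t r <= a i.
  move=> Si nr; apply: ub_le_sup; last by exists r.
  by exists (t q) => _ [z _ <-]; case/andP: (tpq z).
have above i r : S i -> B i r -> b i <= t r.
  move=> Si Br; apply: ge_inf; last by exists r.
  by exists (t p) => _ [z _ <-]; case/andP: (tpq z).
have gap_le i c : S i ->
    (forall r r', ~ B i r -> B i r' -> t r + c <= t r') -> a i + c <= b i.
  move=> Si h; have [_ Bp Bq] := SB i Si.
  apply: lb_le_inf; first by exists (t q), q.
  move=> _ [r' Br' <-]; rewrite -lerBrDr; apply: ge_sup.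
    by exists (t p), p.
  by move=> _ [r Br <-]; rewrite lerBrDr; exact: h.
have ab i : S i -> a i + w i <= b i.
  move=> Si; apply: gap_le => // r r' Br Br'.
  have := gapF [set i] r r' (finite_set1 i); rewrite fsbig_set1; apply.
  - by exists i.
  - by move=> _ ->.
  - by move=> _ ->.
have ab' i : S i -> 0 < b i - a i.
  by move=> Si; have := ab i Si; have [? _ _] := SB i Si; lra.
pose G i : set R := `]a i, b i[%classic.
have GD i : S i -> G i `<=` D.
  move=> Si s; rewrite /G /D/= !in_itv/= => /andP[h1 h2].
  have [_ Bp Bq] := SB i Si; have := below _ _ Si Bp; have := above _ _ Si Bq.
  lra.
have GK i s : S i -> G i s -> ~ K s.
  move=> Si Gs Ks; have [|_ [[r _ <-]]] := Ks (G i).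
    by apply: open_nbhs_nbhs; split => //; exact: interval_open.
  rewrite /G/= in_itv/= => /andP[h1 h2].
  have [Br|Br] := pselect (B i r).
    have := above _ _ Si Br; lra.
  have := below _ _ Si Br; lra.
pose f i (s : R) := w i / (b i - a i) * \1_(G i) s.
have f0 i s : S i -> 0 <= f i s.
  move=> Si; rewrite mulr_ge0// divr_ge0//; last exact/ltW/ab'.
  by have [/ltW] := SB i Si.
have sum_le F s : finite_set F -> F `<=` S -> \sum_(i \in F) f i s <= \1_(~` K) s.
  move=> finF FS; have [[i0 [Fi0 Gi0]]|nG] := pselect (exists i, F i /\ G i s); last first.
    rewrite fsbig1; first by rewrite indicE.
    move=> i Fi; rewrite /f indicE memNset ?mulr0// => Gs.
    by apply: nG; exists i.
  have Si0 := FS _ Fi0.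
  rewrite [leRHS]indicE mem_set/=; last exact: GK Gi0.
  pose Fs := F `&` [set i | G i s].
  have finFs : finite_set Fs by exact: finite_setIl.
  (* All the cuts with a gap at s separate the values of t below s from those above. *)
  have BE i : Fs i -> B i = B i0.
    have cut j r : F j -> G j s -> B j r <-> s < t r.
      move=> Fj; rewrite /G/= in_itv/= => /andP[h1 h2]; split => [Br|].
        have := above _ _ (FS _ Fj) Br; lra.
      by move=> h; apply: contrapT => /(below _ _ (FS _ Fj)); lra.
    move=> [Fi Gi]; apply/seteqP; split => r.
      by move=> /(cut _ _ Fi Gi)/(cut _ _ Fi0 Gi0).
    by move=> /(cut _ _ Fi0 Gi0)/(cut _ _ Fi Gi).
  have -> : \sum_(i \in F) f i s = \sum_(i \in Fs) (w i / (b i0 - a i0)).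
    rewrite -(fsbig_widen Fs F).
    - apply: eq_fsbigr => i; rewrite inE => -[Fi Gi].
      by rewrite /f indicE mem_set// mulr1 /a /b (BE i).
    - by move=> i [].
    - move=> i /= [Fi nFi]; rewrite /f indicE memNset ?mulr0// => Gs.
      by apply: nFi.
  rewrite -mulr_fsuml// ler_pdivrMr ?ab'// mul1r lerBrDl.
  apply: gap_le => // r r' Br Br'; apply: gapF => //.
  - by exists i0.
  - by move=> i [/FS].
  - by move=> i Fsi; rewrite BE.
have mf i : measurable_fun D (EFin \o f i).
  apply/measurable_EFinP; apply: measurable_funM; first exact: measurable_cst.
  by apply: measurable_indic; exact: measurable_itv.
have intf i : S i -> (\int[mu]_(s in D) (f i s)%:E = (w i)%:E)%E.
  move=> Si; under eq_integral do rewrite EFinM.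
  rewrite ge0_integralZl_EFin//.
  - rewrite integral_indic//; last exact: measurable_itv.
    rewrite setIidl; last exact: GD.
    rewrite /= /G lebesgue_measure_itv/= lte_fin ifT; last by have := ab' _ Si; lra.
    by rewrite -EFinB -EFinM divfK// gt_eqF// ab'.
  - by apply/measurable_EFinP; apply: measurable_indic; exact: measurable_itv.
  - by rewrite divr_ge0//; [have [/ltW] := SB i Si|exact/ltW/ab'].
have tpq0 : t p <= t q by case/andP: (tpq q).
have muD : mu D = (t q - t p)%:E.
  rewrite /= /D lebesgue_measure_itv/= lte_fin; case: ltP => // h.
  by have -> : t q = t p by [lra]; rewrite subrr.
apply/negligibleP => //; apply/eqP; rewrite eq_le measure_ge0 andbT.
apply/lee_addgt0Pr => e e0; rewrite add0e.
have [F [finF FS hF]] := approx _ e0.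
have : ((\sum_(i \in F) w i)%:E <= mu (D `\` K))%E.
  rewrite -fsumEFin//.
  rewrite (_ : (\sum_(i \in F) (w i)%:E = \sum_(i \in F) \int[mu]_(s in D) `|f i s|%:E)%E); last first.
    apply: eq_fsbigr => i; rewrite inE => /FS Si; rewrite -intf//.
    by apply: eq_integral => s _; rewrite ger0_norm// f0.
  rewrite -ge0_integral_fsum//; last first.
    move=> i; apply/measurable_EFinP/measurableT_comp => //.
    by have /measurable_EFinP := mf i.
  rewrite (_ : mu (D `\` K) = \int[mu]_(s in D) (\1_(~` K) s)%:E)%E; last first.
    rewrite integral_indic//; last exact: measurableC.
    by rewrite setDE setIC.
  apply: ge0_le_integral => //.
  - by move=> s Ds; rewrite fsume_ge0// => i _; rewrite lee_fin.
  - apply: emeasurable_fsum => // i; apply/measurable_EFinP/measurableT_comp => //.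
    by have /measurable_EFinP := mf i.
  - by apply/measurable_EFinP; apply: measurable_indic; exact: measurableC.
  - move=> s Ds; rewrite fsumEFin// lee_fin.
    rewrite (eq_fsbigr (fun i => f i s)); first exact: sum_le.
    by move=> i; rewrite inE => /FS Si; rewrite ger0_norm// f0.
rewrite measureD//; last by rewrite /= muD ltry.
rewrite setIidr//= muD => h.
have fK : mu K \is a fin_num.
  rewrite ge0_fin_numE// (@le_lt_trans _ _ (mu D))//; last by rewrite muD ltry.
  by rewrite le_measure ?inE.
move: h; rewrite -(fineK fK) -EFinB !lee_fin; lra.
Qed.

End real_null_sets.

(** * The R-tree spanned by a four-point space *)

Section tree_of_four_point.
Context (R : realType) (M : metricType R) (o : M).
Hypothesis fp : four_point M.
Implicit Types p q r u : (M * R)%type.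

(** The pair (x, t) stands for the point at distance t from o on the segment from
o to x. *)
Definition stem : set (M * R) := [set p | 0 <= p.2 <= mdist o p.1].

(** The distance from o at which the segments towards two points separate. *)
Definition pmeet p q : R := Num.min (Num.min p.2 q.2) (gromov o p.1 q.1).

Definition pdist p q : R := p.2 + q.2 - 2 * pmeet p q.

Lemma le_pmeet a p q : (a <= pmeet p q) = [&& a <= p.2, a <= q.2 & a <= gromov o p.1 q.1].
Proof. by rewrite /pmeet !le_min andbA. Qed.

Lemma pmeet_le p q : [/\ pmeet p q <= p.2, pmeet p q <= q.2 &
  pmeet p q <= gromov o p.1 q.1].
Proof. by apply/and3P; rewrite -le_pmeet. Qed.

Lemma pmeetC p q : pmeet p q = pmeet q p.
Proof. by rewrite /pmeet gromovC [Num.min q.2 _]minC. Qed.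

Lemma pmeet_ultra p q r : pmeet p q <= pmeet p r \/ pmeet q r <= pmeet p r.
Proof.
have [a1 a2 a3] := pmeet_le p q; have [b1 b2 b3] := pmeet_le q r.
rewrite !(le_pmeet _ p r); have [h|h] := gromov_ultra fp o p.1 q.1 r.1.
  have [h'|h'] := leP (pmeet p q) (pmeet q r); [left|right]; apply/and3P; split; lra.
have [h'|h'] := leP (pmeet p q) (pmeet q r); [left|right]; apply/and3P; split; lra.
Qed.

Lemma pdistC p q : pdist p q = pdist q p.
Proof. by rewrite /pdist pmeetC; ring. Qed.

Lemma pdist_triangle q p r : pdist p r <= pdist p q + pdist q r.
Proof.
have [a1 a2 a3] := pmeet_le p q; have [b1 b2 b3] := pmeet_le q r.
have := pmeet_ultra p q r; rewrite /pdist; lra.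
Qed.

Lemma gromov_diag x : gromov o x x = mdist o x.
Proof. by rewrite /gromov mdistxx; lra. Qed.

Lemma pdistxx p : stem p -> pdist p p = 0.
Proof.
move=> /andP[p0 pd]; rewrite /pdist /pmeet minxx gromov_diag min_l//; ring.
Qed.

Lemma pdist_four_point p q r u :
  pdist p q + pdist r u <= pdist p r + pdist q u \/
  pdist p q + pdist r u <= pdist p u + pdist q r.
Proof.
have := pmeet_ultra p r q; have := pmeet_ultra p u q.
have := pmeet_ultra r p u; have := pmeet_ultra r q u.
rewrite /pdist (pmeetC r q) (pmeetC u q) (pmeetC r p); lra.
Qed.

(** Distinct pairs may stand for the same point; a chosen representative of each
class avoids a quotient. *)
Definition canon p : M * R := xget (o, 0) [set q | stem q /\ pdist p q = 0].

Lemma canonP p : stem p -> stem (canon p) /\ pdist p (canon p) = 0.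
Proof.
move=> vp; apply: (xgetPex (o, 0) (P := [set q | stem q /\ pdist p q = 0])).
by exists p; split => //; exact: pdistxx.
Qed.

Lemma pdist_congr p q r : pdist p q = 0 -> pdist p r = pdist q r.
Proof.
move=> pq; have := pdist_triangle q p r; have := pdist_triangle p q r.
rewrite (pdistC q p); lra.
Qed.

Lemma canon_congr p q : pdist p q = 0 -> canon p = canon q.
Proof.
move=> pq; congr xget; apply/seteqP.
by split => r /= [vr]; rewrite (pdist_congr r pq).
Qed.

Definition tree_pred : pred (M * R) :=
  fun p => `[< stem p >] && (canon p == p).

Definition four_point_tree (fp : four_point M) := {p : M * R | tree_pred p}.

HB.instance Definition _ := Choice.on (four_point_tree fp).

Lemma tree_stem (p : four_point_tree fp) : stem (val p).
Proof. by case: p => p /= /andP[/asboolP]. Qed.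

Definition tree_dist (p q : four_point_tree fp) := pdist (val p) (val q).

Lemma tree_distxx (p : four_point_tree fp) : tree_dist p p = 0.
Proof. exact/pdistxx/tree_stem. Qed.

Lemma tree_dist_eq0 (p q : four_point_tree fp) : tree_dist p q = 0 -> p = q.
Proof.
move=> /canon_congr; move: p q => [p /= vp] [q /= vq] pq; apply: val_inj => /=.
by move: vp vq => /andP[_ /eqP <-] /andP[_ /eqP <-].
Qed.

HB.instance Definition _ := @isMetric.Build R (four_point_tree fp) tree_dist tree_distxx
  tree_dist_eq0 (fun _ _ => pdistC _ _) (fun _ _ _ => pdist_triangle _ _ _).

Lemma mk_tree_subproof p : stem p -> tree_pred (canon p).
Proof.
move=> /canonP[vp dp]; apply/andP; split; first exact/asboolP.
by apply/eqP/esym/canon_congr.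
Qed.

Definition mk_tree p (vp : stem p) : four_point_tree fp := exist _ (canon p) (mk_tree_subproof vp).

Lemma mdist_treeE (p q : four_point_tree fp) : mdist p q = pdist (val p) (val q).
Proof. by []. Qed.

Lemma mdist_mk_tree (p : four_point_tree fp) q (vq : stem q) :
  mdist p (mk_tree vq) = pdist (val p) q.
Proof.
rewrite mdist_treeE /= pdistC [RHS]pdistC; apply: pdist_congr.
by rewrite pdistC; have [] := canonP vq.
Qed.

Lemma tree_four_point : four_point (four_point_tree fp).
Proof. by move=> p q r u; exact: pdist_four_point. Qed.

Lemma pdist_below p t q : stem p -> t <= p.2 -> pmeet p q <= t ->
  pdist p (p.1, t) = p.2 - t /\ pdist (p.1, t) q = t + q.2 - 2 * pmeet p q.
Proof.
move=> /andP[p0 pd] tp qt; split.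
  rewrite /pdist /pmeet/= gromov_diag min_l ?min_r//; first by lra.
  by rewrite (le_trans _ pd).
rewrite /pdist/=; suff -> : pmeet (p.1, t) q = pmeet p q by [].
apply/le_anti/andP.
have [a1 a2 a3] := pmeet_le (p.1, t) q; have [b1 b2 b3] := pmeet_le p q.
rewrite /= in a1 a2 a3.
by rewrite !le_pmeet /=; split; apply/and3P; split; lra.
Qed.

(** Walking from p to q, one first goes down towards o as far as the branch of q,
and then up; the second half is the first one for q and p. *)
Lemma tree_geodesic : geodesic (four_point_tree fp).
Proof.
move=> p q s /andP[s0]; rewrite mdist_treeE => sd.
wlog: p q s s0 sd / s <= (val p).2 - pmeet (val p) (val q) => [W|h].
  have [|h] := leP s ((val p).2 - pmeet (val p) (val q)); first exact: W.
  have [|||z z1 z2] := W q p (pdist (val p) (val q) - s).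
  - lra.
  - by rewrite pdistC; lra.
  - by rewrite /pdist (pmeetC (val q)); lra.
  exists z; last by rewrite metric_sym z1.
  by rewrite metric_sym z2 (pdistC (val q)); ring.
have [a1 a2 a3] := pmeet_le (val p) (val q).
have /andP[p0 pd] := tree_stem p.
have /andP[q0 qd] := tree_stem q.
have m0 : 0 <= pmeet (val p) (val q) by rewrite le_pmeet p0 q0 gromov_ge0.
have v : stem ((val p).1, (val p).2 - s) by rewrite /stem/=; lra.
have [||e1 e2] := @pdist_below (val p) ((val p).2 - s) (val q) (tree_stem p).
- lra.
- lra.
exists (mk_tree v); first by rewrite mdist_mk_tree e1; ring.
by rewrite metric_sym mdist_mk_tree pdistC e2 /pdist; ring.
Qed.

Lemma tree_rtree : rtree (four_point_tree fp).
Proof. exact: four_point_rtree tree_four_point tree_geodesic. Qed.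

Lemma stem_end x : stem (x, mdist o x).
Proof. by rewrite /stem/= mdist_ge0 lexx. Qed.

Definition tree_inj x : four_point_tree fp := mk_tree (stem_end x).

Lemma tree_inj_isometry x y : mdist (tree_inj x) (tree_inj y) = mdist x y.
Proof.
have [_ ix] := canonP (stem_end x).
rewrite mdist_mk_tree -(pdist_congr _ ix).
rewrite /pdist /pmeet/= min_r; first by rewrite /gromov; lra.
rewrite le_min /gromov.
have := metric_triangle o x y; have := metric_triangle o y x.
by rewrite (metric_sym y x) => h1 h2; apply/andP; split; lra.
Qed.

End tree_of_four_point.

(** * Null sets in the tree of an embedding *)

Section embedding_to_tree.
Context (R : realType) (M : metricType R) (o : M) (I : choiceType).
Variable J : {linear lipfree o -> ell1 R I}.
Hypothesis Jiso : forall u, `|J u| = `|u|.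
Local Notation mu := (@lebesgue_measure R).

Lemma coord_approx p q e : 0 < e ->
  exists F : set I, [/\ finite_set F, F `<=` [set i | coord J p i <> coord J q i] &
    mdist p q <= \sum_(i \in F) `|coord J p i - coord J q i| + e].
Proof.
move=> e0; pose v := J (ldelta o p - ldelta o q).
have vE : (mdist p q)%:E = \esum_(i in [set: I]) `|v i|%:E.
  by rewrite -(molecule_norm o) -Jiso -ell1_normE.
have [|_ [F [finF _] <-]] := @ub_ereal_sup_adherent R
    [set (\sum_(i \in A) `|v i|%:E)%E | A in fsets [set: I]] e e0.
  by move: vE; rewrite /esum => <-.
rewrite -[ereal_sup _]/(\esum_(i in [set: I]) `|v i|%:E) -vE => h.
exists (F `&` [set i | coord J p i <> coord J q i]); split => //.
  exact: finite_setIl.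
rewrite (fsbig_widen _ F); last 2 first.
- by move=> i [].
- move=> i /= [Fi nFi]; have -> : coord J p i = coord J q i.
    by apply: contrapT => ?; apply: nFi.
  by rewrite subrr normr0.
move: h; rewrite fsumEFin// -EFinB lte_fin.
rewrite (eq_fsbigr (fun i => `|coord J p i - coord J q i|)); first lra.
by move=> i _; rewrite /v coordB.
Qed.

(** The cuts that separate p from q weigh d(p, q) in total and give the gaps of
the projections on [p, q]. The constant c allows any origin on the segment. *)
Lemma projection_negligible p q c :
  mu.-negligible (closure (range (fun r : M => gromov p q r + c))).
Proof.
have tp : gromov p q p = 0 by rewrite /gromov mdistxx (metric_sym q p); lra.
have tq : gromov p q q = mdist p q by rewrite /gromov mdistxx; lra.
apply: (@gaps_negligible R M I (fun r : M => gromov p q r + c) p q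
  [set i | coord J p i <> coord J q i]
  (fun i => `|coord J p i - coord J q i|) (fun i r => coord J r i = coord J q i)).
- move=> r; rewrite tp tq; have := gromov_ge0 p q r.
  have : gromov p q r <= mdist p q.
    by rewrite /gromov; have := metric_triangle p q r; lra.
  lra.
- by move=> i /eqP pq; split; [rewrite normr_gt0 subr_eq0|apply/eqP|].
- move=> F r r' finF F0 FS h.
  suff : gromov p q r + \sum_(i \in F) `|coord J p i - coord J q i| <= gromov p q r'.
    by lra.
  apply: (gap_length Jiso) => // i Fi; have [nr r'q] := h i Fi.
  have pq := FS i Fi; split => //.
  by have [|->|/esym] := coord_two_values Jiso p q r i.
- move=> e e0; have [F [finF FS h]] := coord_approx p q e0.
  by exists F; split => //; rewrite tp tq; lra.
Qed.

Variables (T : metricType R) (iota : M -> T).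
Hypothesis tT : rtree T.
Hypothesis isoi : forall x y, mdist (iota x) (iota y) = mdist x y.
Let C := rconv (range iota).

Lemma gromov_iota p q r : gromov (iota p) (iota q) (iota r) = gromov p q r.
Proof. by rewrite /gromov !isoi. Qed.

(** A segment [x, y] of the hull is part of a segment [p, q] with ends in M; there
the distance to x is the position of the projection on [p, q], shifted. *)
Lemma projected_null (E : set T) :
  (forall z p q c, E z -> closure (range (fun r : M => gromov p q r + c))
     (gromov (iota p) (iota q) z + c)) ->
  length_null C E.
Proof.
move=> hE.
have neg x y : C x -> C y -> mu.-negligible (mdist x @` (E `&` segment x y)).
  move=> Cx Cy.
  have [_ [_ [[p _ <-] [q _ <-] pqy pyx]]] := rconv_extend2 tT Cx Cy.
  apply: (negligibleS _ (projection_negligible p q (- mdist (iota p) x))).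
  move=> _ [z [Ez sz] <-]; move: sz; rewrite (rtree_segmentE tT) => xyz.
  have [pyz _ pz] := between_trans pyx xyz.
  have [qpz _ _] := between_trans (between_sym pqy) (between_sym pyz).
  have := hE z p q (- mdist (iota p) x) Ez.
  by rewrite (between_gromovE (between_sym qpz)) pz addrAC subrr add0r.
split => [x y Cx Cy|]; first exact/(negligible_completed _).1/neg.
apply/eqP; rewrite eq_le; apply/andP; split; last first.
  apply: ereal_sup_ubound; exists 0%N, (fun=> iota o), (fun=> iota o).
  split; last by rewrite big_ord0.
    by move=> k; have := ltn_ord k.
  by move=> k; have := ltn_ord k.
apply: ge_ereal_sup => _ [n [x [y [Cxy _ ->]]]].
rewrite big1// => k _; have [Cx Cy] := Cxy k.
by have [_] := negligible_completed (neg _ _ Cx Cy).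
Qed.

Lemma closure_shift (A : set T) p q c (B : set R) z :
  (forall w, A w -> B (gromov (iota p) (iota q) w + c)) ->
  closure A z -> closure B (gromov (iota p) (iota q) z + c).
Proof.
move=> AB clA U nU.
have cg : continuous (fun w => gromov (iota p) (iota q) w + c : R).
  move=> w; apply: cvgD; last exact: cvg_cst.
  exact: gromov_continuous.
by have [w [Aw Uw]] := clA _ (cg z _ nU); exists (gromov (iota p) (iota q) w + c); split => //; exact: AB.
Qed.

Lemma iota_null : length_null C (range iota).
Proof.
apply: projected_null => _ p q c [r _ <-].
by apply: subset_closure; exists r => //; rewrite gromov_iota.
Qed.

Lemma branching_null : length_null C (closure (branching C) `&` C).
Proof.
apply: projected_null => z p q c [clz _]; apply: closure_shift clz => w.
move=> /(branching_project tT (iota p) (iota q))[_ [r _ <-] [pw qw]].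
exists r => //; rewrite -gromov_iota; congr (_ + _).
move: pw qw; rewrite /between/= /gromov (metric_sym w (iota r)); lra.
Qed.

End embedding_to_tree.

Lemma ell1_embedding_tree (R : realType) (M : metricType R) (o : M)
    (I : choiceType) (J : {linear lipfree o -> ell1 R I}) :
  (forall u, `|J u| = `|u|) ->
  exists (T : metricType R) (iota : M -> T),
     [/\ rtree T,
         forall x y, mdist (iota x) (iota y) = mdist x y,
         length_null (rconv (range iota)) (range iota)
       & length_null (rconv (range iota))
           (closure (branching (rconv (range iota))) `&` rconv (range iota))].
Proof.
move=> Jiso; have fp := coord_four_point Jiso.
exists (four_point_tree o fp), (@tree_inj _ _ o fp).
have tT := @tree_rtree _ _ o fp.
have isoi := @tree_inj_isometry _ _ o fp.
split => //; [exact: (iota_null Jiso tT isoi)|exact: (branching_null Jiso tT isoi)].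
Qed.

(** * Gaps of a closed null set in an R-tree *)

Lemma lebesgue_cover_le (R : realType) (I : choiceType) (s : seq I)
    (D V : set R) (G : I -> set R) :
  measurable D -> measurable V -> (forall i, measurable (G i)) ->
  D `<=` V `|` \bigcup_(i in [set` s]) G i ->
  (lebesgue_measure D <= lebesgue_measure V + \sum_(i <- s) lebesgue_measure (G i))%E.
Proof.
move=> mD mV mG; elim: s V mV => [|i s IHs] V mV DV.
  rewrite big_nil adde0 le_measure ?inE// => x /DV[//|[i]].
  by rewrite /= in_nil.
have mVi : measurable (V `|` G i) by exact: measurableU.
rewrite big_cons addeA; apply: (le_trans (IHs (V `|` G i) mVi _)).
  move=> x /DV[Vx|[j /=]]; first by left; left.
  rewrite inE => /predU1P[->|js] Gx; first by left; right.
  by right; exists j.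
by apply: leeD2r; apply: (measureU2 (@lebesgue_measure R)) => //; exact: mG.
Qed.

Section gaps.
Context (R : realType) (T : metricType R).
Hypothesis tT : rtree T.
Variables (M0 : set T) (O : T).
Hypothesis M0O : M0 O.
Hypothesis M0closed : closed M0.
Local Notation mu := (@lebesgue_measure R).
Let fp := rtree_four_point tT.
Let C := rconv M0.
Implicit Types x y z u v w : T.

(** What has to be removed from the hull of M0 for the rest to consist of open
segments. *)
Definition skeleton := M0 `|` (closure (branching C) `&` C).
Definition offskeleton := C `\` skeleton.
(** The component of u off the skeleton, described by segments. *)
Definition gap u := [set v | between u v `<=` offskeleton].
Definition is_gap (g : set T) := exists2 u, offskeleton u & g = gap u.
Local Notation h := (mdist O).
(** Heights over O identify a gap with an interval, whichever segment [O, x] it is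
seen on. *)
Definition gap_bot (g : set T) := inf (h @` g).
Definition gap_top (g : set T) := sup (h @` g).

Lemma between_l x y : between x y x.
Proof. by rewrite /between/= mdistxx add0r. Qed.

Lemma between_r x y : between x y y.
Proof. by rewrite /between/= mdistxx addr0. Qed.

Lemma between_third u x y z : between x y z -> between x u z \/ between u y z.
Proof.
move=> /gromov0P e; have := gromov_ultra fp z x u y.
have := gromov_ge0 z x u; have := gromov_ge0 z u y; rewrite e => h1 h2 [h3|h3].
  by left; apply/gromov0P; lra.
by right; apply/gromov0P; lra.
Qed.

(** The segments [O, x] and [O, y] agree up to the height at which they separate. *)
Lemma below_gromov x y z : between O x z -> h z <= gromov O x y -> between O y z.
Proof.
move=> oxz zxy; have := between_gromovE oxz; rewrite gromovC => e.
have := gromov_ultra fp O z x y; rewrite e => zy.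
have {}zy : h z <= gromov O z y by lra.
rewrite /between/=; move: zy; rewrite /gromov.
have := metric_triangle O z y; lra.
Qed.

Lemma offskeleton_near u : offskeleton u ->
  exists2 e, 0 < e & forall v, C v -> mdist u v < e -> offskeleton v.
Proof.
move=> [Cu nu].
have : nbhs u (~` (M0 `|` closure (branching C))).
  apply: open_nbhs_nbhs; split; last first.
    by move=> [Mu|Bu]; apply: nu; [left|right].
  by apply: closed_openC; apply: closedU => //; exact: closed_closure.
move=> /nbhs_distP[e e0 he]; exists e => // v Cv uv; split => //.
by move=> [Mv|[Bv _]]; apply: (he v uv); [left|right].
Qed.

Lemma gap_self u : offskeleton u -> gap u u.
Proof.
move=> Uu z; rewrite /between/= mdistxx (metric_sym z u) => e.
have -> : z = u by apply/esym/mdist_positivity; have := mdist_ge0 u z; lra.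
exact: Uu.
Qed.

Lemma gap_off u v : gap u v -> offskeleton v.
Proof. by apply; exact: between_r. Qed.

Lemma gap_sub u v w : gap u v -> gap u w -> between v w `<=` offskeleton.
Proof.
by move=> uv uw z /(between_third u)[/between_sym/uv|/uw].
Qed.

Lemma gap_eq u v : gap u v -> gap v = gap u.
Proof.
move=> uv; have vu : gap v u by move=> z /between_sym/uv.
by apply/seteqP; split => w; apply: gap_sub.
Qed.

Lemma gap_mem g v : is_gap g -> g v -> g = gap v.
Proof. by move=> [u Uu ->] /gap_eq ->. Qed.

(** Otherwise the projection w of v on [O, x] is in the gap too, as it is between
u and v; but O, x and v lie in three different directions from w, which is
therefore a branching point. *)
Lemma gap_in_branch x u v : M0 x -> between O x u -> gap u v -> between O x v.
Proof.
move=> Mx Oxu uv; have [w [Oxw Ovw xvw]] := rtree_median tT O x v.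
have [-> //|wv] := eqVneq v w; exfalso.
have uvw : between u v w.
  apply/gromov0P/eqP; rewrite eq_le gromov_ge0 andbT leNgt; apply/negP => gt0.
  have z0 z : between z v w -> between z u w.
    move=> zvw; apply/gromov0P/eqP; rewrite eq_le gromov_ge0 andbT leNgt.
    apply/negP => zu; have := gromov_gt0_trans fp zu gt0.
    by move/gromov0P: zvw => ->; rewrite ltxx.
  have := z0 _ Ovw; have := z0 _ xvw; move: Oxu Oxw; rewrite /between/=.
  rewrite (metric_sym x w) (metric_sym u x) => e1 e2 e3 e4.
  have wu : w = u by apply: mdist_positivity; lra.
  by move: gt0; rewrite wu /gromov mdistxx; lra.
have [Cw nw] := uv _ uvw; apply: nw; right; split => //; apply: subset_closure.
have nM z : M0 z -> z <> w.
  by move=> Mz zw; have [_] := uv _ uvw; apply; left; rewrite -zw.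
(* The default value v serves as the third point. *)
pose y i := nth v [:: O; x] i.
apply: (branching_intro tT (y := y)) => //.
  move=> [|[|[|//]]] _ /=; split; try exact: sub_rconv.
  - exact: nM.
  - exact: nM.
  - by have [] := gap_off uv.
  - by apply/eqP.
by move=> [|[|[|//]]] [|[|[|//]]] //= _ _ _; rewrite /y/=; try exact: between_sym.
Qed.

Definition gap_on x g := is_gap g /\ g `<=` between O x.

Lemma between_inj x v w : between O x v -> between O x w -> h v = h w -> v = w.
Proof.
move=> Ov Ow vw; apply: mdist_positivity.
by rewrite (between_mdist fp Ov Ow) vw ?subrr.
Qed.

Lemma between_heights x u v w : between O x u -> between O x v -> between O x w ->
  h u <= h v -> h v <= h w -> between u w v.
Proof.
move=> Ou Ov Ow uv vw; rewrite /between/= (between_mdist fp Ou Ov)//.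
rewrite (between_mdist fp Ov Ow)// (between_mdist fp Ou Ow) //; lra.
Qed.

Lemma between_point x s : 0 <= s <= h x -> exists2 z, between O x z & h z = s.
Proof.
move=> /(rtree_geodesic tT)[z z1 z2]; exists z => //.
by rewrite /between/= z1 z2; lra.
Qed.

Lemma between_height x z : between O x z -> 0 <= h z <= h x.
Proof. by rewrite /between/= mdist_ge0; have := mdist_ge0 z x; lra. Qed.

Lemma branch_sub x : M0 x -> between O x `<=` C.
Proof. by move=> Mx; apply: (rconv_convex tT); exact: sub_rconv. Qed.

Lemma is_gap_point g : is_gap g -> exists2 u, offskeleton u & g u.
Proof. by move=> [u Uu ->]; exists u => //; exact: gap_self. Qed.

Lemma is_gap_off g v : is_gap g -> g v -> offskeleton v.
Proof. by move=> [u Uu ->]; exact: gap_off. Qed.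

Lemma gap_on_intro x g v : M0 x -> is_gap g -> g v -> between O x v -> gap_on x g.
Proof.
move=> Mx gg gv Oxv; split => //; rewrite (gap_mem gg gv) => w vw.
exact: gap_in_branch vw.
Qed.

Lemma gap_on_branch g : is_gap g -> exists2 x, M0 x & gap_on x g.
Proof.
move=> gg; have [u [Cu _] gu] := is_gap_point gg.
have [x Mx xOu] := rconv_extend tT O Cu.
by exists x => //; apply: (gap_on_intro Mx gg gu); exact: between_sym.
Qed.

Section on_branch.
Variables (x : T) (g : set T).
Hypotheses (Mx : M0 x) (gx : gap_on x g).

Lemma gap_on_has_ubound : has_ubound (h @` g).
Proof. by exists (h x) => _ [v /gx.2/between_height/andP[_ hv] <-]. Qed.

Lemma gap_on_has_lbound : has_lbound (h @` g).
Proof. by exists 0 => _ [v /gx.2/between_height/andP[hv _] <-]. Qed.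

Lemma gap_on_neq0 : h @` g !=set0.
Proof. by have [u _ gu] := is_gap_point gx.1; exists (h u), u. Qed.

Lemma gap_bot_ge0 : 0 <= gap_bot g.
Proof.
apply: lb_le_inf; first exact: gap_on_neq0.
by move=> _ [v /gx.2/between_height/andP[hv _] <-].
Qed.

Lemma gap_top_le : gap_top g <= h x.
Proof.
apply: ge_sup; first exact: gap_on_neq0.
by move=> _ [v /gx.2/between_height/andP[_ hv] <-].
Qed.

Lemma gap_on_mem v : between O x v -> gap_bot g < h v < gap_top g -> g v.
Proof.
move=> Oxv /andP[lo hi].
have [_ [v1 gv1 <-] h1] := inf_lt gap_on_neq0 lo.
have [_ [v2 gv2 <-] h2] := sup_gt gap_on_neq0 hi.
have v12 : between v1 v2 v.
  exact: (between_heights (gx.2 _ gv1) Oxv (gx.2 _ gv2) (ltW h1) (ltW h2)).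
have g12 := gv2; rewrite (gap_mem gx.1 gv1) in g12 *.
move=> z v1v; apply: g12.
by have [/between_sym] := between_trans (between_sym v12) (between_sym v1v).
Qed.

(** A gap is open, so it has no lowest and no highest point. *)
Lemma gap_on_lt v : g v -> gap_bot g < h v < gap_top g.
Proof.
move=> gv; have Uv := is_gap_off gx.1 gv; have Oxv := gx.2 _ gv.
have [Cv nv] := Uv; have [e e0 he] := offskeleton_near Uv.
have [v0 vx] : 0 < h v /\ h v < h x.
  have /andP[h0 h1] := between_height Oxv; split; rewrite lt_neqAle ?h0 ?h1 andbT.
    apply/eqP => v0; apply: nv; left; suff <- : O = v by [].
    by apply: between_inj (between_l _ _) Oxv _; rewrite mdistxx.
  apply/eqP => vx; apply: nv; left; suff -> : v = x by [].
  exact: between_inj Oxv (between_r _ _) _.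
have near_mem w : between O x w -> mdist v w < e -> g w.
  move=> Oxw vw; rewrite (gap_mem gx.1 gv) => z vwz; apply: he.
    by apply: (rconv_convex tT Cv _ vwz); exact: branch_sub Oxw.
  apply: le_lt_trans vw; move: vwz; rewrite /between/=.
  by have := mdist_ge0 z w; lra.
(* A step d that stays off the skeleton and inside the segment [O, x]. *)
pose d := Num.min (e / 2) (Num.min (h v) (h x - h v)).
have [d0 d1 d2 d3] : [/\ 0 < d, d < e, d <= h v & d <= h x - h v].
  have e2 : 0 < e / 2 by lra.
  rewrite /d !lt_min e2 v0 subr_gt0 vx/=; split => //.
  - by rewrite gt_min; apply/orP; left; lra.
  - by rewrite !ge_min lexx orbT.
  - by rewrite !ge_min lexx !orbT.
apply/andP; split.
  have [|w Oxw hw] := @between_point x (h v - d); first by lra.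
  apply: (@le_lt_trans _ _ (h w)); last by rewrite hw; lra.
  apply: ge_inf; first exact: gap_on_has_lbound.
  exists w => //; apply: near_mem => //; rewrite metric_sym.
  rewrite (between_mdist fp Oxw Oxv) hw; lra.
have [|w Oxw hw] := @between_point x (h v + d); first by lra.
apply: (@lt_le_trans _ _ (h w)); first by rewrite hw; lra.
apply: ub_le_sup; first exact: gap_on_has_ubound.
exists w => //; apply: near_mem => //.
rewrite (between_mdist fp Oxv Oxw) hw; lra.
Qed.

Lemma gap_bot_lt_top : gap_bot g < gap_top g.
Proof.
by have [u _ gu] := is_gap_point gx.1; have /andP[] := gap_on_lt gu; exact: lt_trans.
Qed.

End on_branch.

Lemma gap_on_disjoint x g g' : M0 x -> gap_on x g -> gap_on x g' -> g != g' ->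
  gap_top g <= gap_bot g' \/ gap_top g' <= gap_bot g.
Proof.
move=> Mx gx gx' gg'.
have [h1|h1] := leP (gap_top g) (gap_bot g'); first by left.
have [h2|h2] := leP (gap_top g') (gap_bot g); first by right.
exfalso; move/eqP : gg'; apply.
have [k1 k2] := (gap_bot_lt_top Mx gx, gap_bot_lt_top Mx gx').
have [k3 k4] := (gap_bot_ge0 gx, gap_bot_ge0 gx').
have [k5 k6] := (gap_top_le gx, gap_top_le gx').
have [s [s1 s2 s3 s4]] : exists s, [/\ gap_bot g < s, gap_bot g' < s, s < gap_top g & s < gap_top g'].
  exists ((Num.max (gap_bot g) (gap_bot g') + Num.min (gap_top g) (gap_top g')) / 2).
  by rewrite maxEle minEle; do 2 case: ifPn; rewrite -?ltNge => ? ?; split; lra.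
have [|z Oxz hz] := @between_point x s; first by lra.
have gz : g z by apply: (gap_on_mem gx) => //; rewrite hz s1.
have gz' : g' z by apply: (gap_on_mem gx') => //; rewrite hz s2.
by rewrite (gap_mem gx.1 gz) (gap_mem gx'.1 gz').
Qed.

Lemma increments_gap_le x l (f : R -> R) (s : seq (set T)) : M0 x -> 0 <= l <= h x ->
  {in `[0, h x] &, {homo f : r r' / r <= r'}} -> uniq s ->
  (forall g, g \in s -> gap_on x g /\ l <= gap_bot g) ->
  \sum_(g <- s) (f (gap_top g) - f (gap_bot g)) <= f (h x) - f l.
Proof.
move=> Mx /andP[l0 lx] fh us hs; apply: increments_le => //.
- move=> r r'; rewrite !in_itv/= => h1 h2; apply: fh; rewrite in_itv/=; lra.
- move=> g /hs[gx lg]; split => //; last exact: (gap_top_le gx).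
  by have := gap_bot_lt_top Mx gx; lra.
- by move=> g g' /hs[gx _] /hs[gx' _]; exact: (gap_on_disjoint Mx gx gx').
Qed.

Lemma gromov_between x y v : between O x v -> between O y v -> h v <= gromov O x y.
Proof.
move=> Ox Oy; have := gromov_ultra fp O x v y.
by rewrite (between_gromovE Ox) [gromov O v y]gromovC (between_gromovE Oy); lra.
Qed.

(** The ends of a gap are the same seen from all the segments [O, x] that contain
it, since these segments agree up to the top of the gap. *)
Lemma gap_ends g : exists zz : T * T, is_gap g -> forall x, M0 x -> gap_on x g ->
  [/\ between O x zz.1, h zz.1 = gap_bot g, between O x zz.2 & h zz.2 = gap_top g].
Proof.
have [gg|ng] := pselect (is_gap g); last by exists (O, O).
have [y My gy] := gap_on_branch gg.
have b0 := gap_bot_ge0 gy; have ty := gap_top_le gy; have bt := gap_bot_lt_top My gy.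
have [|z1 Oz1 h1] := @between_point y (gap_bot g); first by lra.
have [|z2 Oz2 h2] := @between_point y (gap_top g); first by lra.
exists (z1, z2) => _ x Mx gx /=.
have yx : gap_top g <= gromov O y x.
  apply: ge_sup; first exact: (gap_on_neq0 gy).
  by move=> _ [v gv <-]; apply: gromov_between; [exact: gy.2|exact: gx.2].
by split => //; apply: below_gromov; rewrite ?h1 ?h2; eauto; lra.
Qed.

(** The functions r + F and r - F, read along [O, x] by height r, are
nondecreasing; so the increments of each over disjoint gaps add up to at most its
total increment. *)
Lemma lipschitz_increments (F : T -> R) : (forall u v, F v - F u <= mdist u v) ->
  exists D : set T -> R,
    (forall g, is_gap g -> `|D g| <= gap_top g - gap_bot g) /\
    forall x s, M0 x -> uniq s -> (forall g, g \in s -> gap_on x g) ->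
      `|F x - F O - \sum_(g <- s) D g| <= h x - \sum_(g <- s) (gap_top g - gap_bot g).
Proof.
move=> F1; have [zz zzP] := choice gap_ends.
exists (fun g => F (zz g).2 - F (zz g).1); split.
  move=> g gg; have [x Mx gx] := gap_on_branch gg.
  have [k1 h1 k2 h2] := zzP g gg x Mx gx; have bt := gap_bot_lt_top Mx gx.
  have d12 : mdist (zz g).1 (zz g).2 = gap_top g - gap_bot g.
    by rewrite (between_mdist fp k1 k2) h1 h2//; exact: ltW.
  rewrite ler_norml; have := F1 (zz g).1 (zz g).2; have := F1 (zz g).2 (zz g).1.
  by rewrite (metric_sym (zz g).2) d12; lra.
move=> x s Mx us sx.
have ptE r : exists z, 0 <= r <= h x -> between O x z /\ h z = r.
  have [/between_point[z z1 z2]|nr] := pselect (0 <= r <= h x); last by exists O.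
  by exists z.
have [pt ptP] := choice ptE.
have pt_eq z : between O x z -> pt (h z) = z.
  move=> Oz; have [Op hp] := ptP _ (between_height Oz).
  exact: between_inj Op Oz hp.
have ptd r r' : 0 <= r -> r <= r' -> r' <= h x -> mdist (pt r) (pt r') = r' - r.
  move=> r0 rr' r'x.
  have [|k1 h1] := ptP r; first by lra.
  have [|k2 h2] := ptP r'; first by lra.
  by rewrite (between_mdist fp k1 k2) h1 h2.
have hx0 : 0 <= h x by exact: mdist_ge0.
have h0x : 0 <= (0 : R) <= h x by rewrite lexx.
have hO : h O = 0 by exact: mdistxx.
have ends g : g \in s -> F (pt (gap_top g)) = F (zz g).2 /\ F (pt (gap_bot g)) = F (zz g).1.
  move=> /sx gx; have [k1 <- k2 <-] := zzP g gx.1 x Mx gx.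
  by rewrite !pt_eq.
have pt0 : pt 0 = O by rewrite -hO pt_eq//; exact: between_l.
have ptx : pt (h x) = x by rewrite pt_eq//; exact: between_r.
have key (c : R) : c = 1 \/ c = -1 ->
    \sum_(g <- s) ((gap_top g - gap_bot g) + c * (F (zz g).2 - F (zz g).1)) <=
    h x + c * (F x - F O).
  move=> c1; pose f r := r + c * F (pt r).
  have -> : h x + c * (F x - F O) = f (h x) - f 0.
    by rewrite /f pt0 ptx; ring.
  rewrite (eq_big_seq (fun g => f (gap_top g) - f (gap_bot g))); last first.
    by move=> g /ends[e1 e2]; rewrite /f e1 e2; ring.
  apply: (increments_gap_le Mx) => //.
    move=> r r'; rewrite !in_itv/= => /andP[r0 _] /andP[_ r'x] rr'.
    have d := ptd _ _ r0 rr' r'x; rewrite /f.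
    have := F1 (pt r) (pt r'); have := F1 (pt r') (pt r).
    rewrite (metric_sym (pt r')) d.
    by case: c1 => ->; lra.
  by move=> g /sx gx; split => //; exact: gap_bot_ge0 gx.
have key' c : c = 1 \/ c = -1 -> \sum_(g <- s) (gap_top g - gap_bot g) +
    c * \sum_(g <- s) (F (zz g).2 - F (zz g).1) <= h x + c * (F x - F O).
  by move=> c1; have := key c c1; rewrite big_split/= -mulr_sumr.
have := key' 1 (or_introl erefl); have := key' (-1) (or_intror erefl).
by rewrite ler_norml /=; lra.
Qed.

Hypothesis null_M0 : length_null C M0.
Hypothesis null_branching : length_null C (closure (branching C) `&` C).

Lemma length_null_negligible E x : length_null C E -> C x ->
  mu.-negligible (h @` (E `&` between O x)).
Proof.
move=> [_ E0] Cx; apply: completed_negligible; apply/eqP.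
rewrite eq_le measure_ge0 andbT -[leRHS]E0 -(rtree_segmentE tT).
apply: ereal_sup_ubound; exists 1%N, (fun=> O), (fun=> x); split.
- by move=> _; split => //; exact: sub_rconv.
- by move=> i j _ _ _; rewrite (ord1 i) (ord1 j).
- by rewrite big_ord1.
Qed.

(** Enclose the heights of the skeleton in an open set of measure at most e. The
remaining heights form a compact set covered by the gaps, hence by finitely many. *)
Lemma gap_cover x e : M0 x -> 0 < e -> exists s : seq (set T),
  [/\ uniq s, forall g, g \in s -> gap_on x g &
    h x - e <= \sum_(g <- s) (gap_top g - gap_bot g)].
Proof.
move=> Mx e0; have Cx : C x by exact: sub_rconv.
pose N := h @` (skeleton `&` between O x).
have N0 : mu.-negligible N.
  apply: negligibleS (negligibleU (length_null_negligible null_M0 Cx)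
    (length_null_negligible null_branching Cx)).
  by move=> _ [z [[Mz|Bz] Oz] <-]; [left|right]; exists z.
have [V [oV NV Ve]] := outer_measure_open_le N e0.
have VE : (mu V <= e%:E)%E.
  by apply: (le_trans Ve); rewrite (negligible_outer_measure N).1// add0e.
pose Q := `[0, h x]%classic `&` ~` V.
have cQ : compact Q.
  apply: (subclosed_compact _ (@segment_compact _ 0 (h x))); last first.
    by move=> r [].
  apply: closedI; first exact: itv_closed.
  exact: open_closedC.
pose G (g : set T) : set R := `]gap_bot g, gap_top g[%classic.
move: cQ; rewrite compact_cover => /(_ (set T) (gap_on x) G)[||D' D'x QD'].
- by move=> g _; exact: interval_open.
- move=> r [/=]; rewrite in_itv/= => /between_point[z Oxz hz] nV.
  have Uz : offskeleton z.
    split; first exact: branch_sub Oxz.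
    by move=> Sz; apply: nV; apply: NV; exists z.
  have gz : gap_on x (gap z).
    by apply: (gap_on_intro Mx _ (gap_self Uz) Oxz); exists z.
  exists (gap z) => //; rewrite /G/= in_itv/= -hz.
  exact: (gap_on_lt Mx gz (gap_self Uz)).
exists (finmap.enum_fset D'); split; first exact: finmap.fset_uniq.
  by move=> g gD; have := D'x g gD; rewrite inE.
have hx0 : 0 <= h x by exact: mdist_ge0.
have cover : `[0, h x]%classic `<=` V `|` \bigcup_(g in [set` finmap.enum_fset D']) G g.
  by move=> r hr; have [Vr|nVr] := pselect (V r); [left|right; exact: (QD' r)].
have := @lebesgue_cover_le R _ _ _ V G (measurable_itv _) (open_measurable oV)
  (fun=> measurable_itv _) cover.
have -> : mu `[0, h x]%classic = (h x)%:E.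
  rewrite lebesgue_measure_itv/= lte_fin; case: ltP => [_|hx]; first by rewrite -EFinB subr0.
  by have -> : h x = 0 by lra.
rewrite (eq_big_seq (fun g => (gap_top g - gap_bot g)%:E)); last first.
  move=> g gD; rewrite /G lebesgue_measure_itv/= lte_fin ifT ?EFinB//.
  by have := D'x g gD; rewrite inE => gx; exact: (gap_bot_lt_top Mx gx).
move=> /le_trans /(_ (leeD2r _ VE)); rewrite sumEFin -EFinD lee_fin; lra.
Qed.

End gaps.

(** * The embedding given by the gaps *)

Lemma isometry_range_closed (R : realType) (M : completeMetricType R)
    (T : metricType R) (iota : M -> T) :
  (forall x y, mdist (iota x) (iota y) = mdist x y) -> closed (range iota).
Proof.
move=> iso z clz.
have near e : 0 < e -> exists r, mdist z (iota r) < e.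
  move=> e0; have [|_ [[r _ <-] h]] := clz [set u | mdist z u < e].
    by apply/nbhs_distP; exists e.
  by exists r.
pose B e := [set r | mdist z (iota r) < e].
pose F := filter_from [set e : R | 0 < e] B.
have FF : ProperFilter F.
  apply: filter_from_proper; last by move=> e /= /near[r hr]; exists r.
  apply: filter_from_filter; first by exists 1 => /=.
  move=> i j /= i0 j0; exists (Num.min i j); first by rewrite /= lt_min i0.
  by move=> r /=; rewrite /B/= lt_min => /andP[].
have /cauchy_cvg cF : cauchy F.
  apply: cauchy_exP => e e0; have e2 : 0 < e / 2 by lra.
  have [r hr] := near _ e2; exists r; exists (e / 2) => //= r' hr'.
  rewrite ballEmdist/= -iso; rewrite /B/= in hr'.
  by have := metric_triangle (iota r) z (iota r'); rewrite (metric_sym (iota r) z); lra.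
exists (lim F) => //; apply/esym/mdist_positivity/eqP.
rewrite eq_le mdist_ge0 andbT; apply/ler_addgt0Pl => e e0; rewrite addr0.
have e2 : 0 < e / 2 by lra.
have : F (B (e / 2) `&` [set r | mdist (lim F) r < e / 2]).
  apply: filterI; first by exists (e / 2).
  by apply: cF; apply/nbhs_distP; exists (e / 2).
move=> /filter_ex[r [/= h1 h2]]; rewrite /B/= in h1; rewrite -iso in h2.
have := metric_triangle z (iota r) (iota (lim F)).
by rewrite (metric_sym (iota r) (iota _)); lra.
Qed.

Section tree_to_ell1.
Context (R : realType) (M : completeMetricType R) (o : M).
Variables (T : metricType R) (iota : M -> T).
Hypothesis tT : rtree T.
Hypothesis isoi : forall x y, mdist (iota x) (iota y) = mdist x y.
Let M0 := range iota.
Let O := iota o.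
Let fp := rtree_four_point tT.
Hypothesis null_M0 : length_null (rconv M0) M0.
Hypothesis null_branching :
  length_null (rconv M0) (closure (branching (rconv M0)) `&` rconv M0).
Implicit Types (x y : M) (g : set T).

Let M0x x : M0 (iota x). Proof. by exists x. Qed.
Let M0closed : closed M0. Proof. exact: isometry_range_closed. Qed.

Definition gap_length_on g x : R :=
  if `[< gap_on M0 O (iota x) g >] then gap_top O g - gap_bot O g else 0.

(** The gaps counted for x but not for y lie on [O, x] above the median m of O, x
and y; being disjoint, they have total length at most d(m, x). *)
Lemma gap_length_on_lipschitz (s : seq (set T)) x y : uniq s ->
  \sum_(g <- s) `|gap_length_on g x - gap_length_on g y| <= mdist x y.
Proof.
move=> us; have [m [Oxm Oym xym]] := rtree_median tT O (iota x) (iota y).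
have half u v : between O (iota u) m -> between O (iota v) m ->
    \sum_(g <- s | `[< gap_on M0 O (iota u) g >] && ~~ `[< gap_on M0 O (iota v) g >])
      (gap_top O g - gap_bot O g) <= mdist m (iota u).
  move=> Oum Ovm; rewrite -big_filter.
  have -> : mdist m (iota u) = mdist O (iota u) - mdist O m.
    by move: Oum; rewrite /between/=; lra.
  apply: (increments_gap_le tT (M0x o) M0closed (f := id) (M0x u)) => //.
  - exact: between_height.
  - exact: filter_uniq.
  - move=> g; rewrite mem_filter => /andP[/andP[/asboolP gu /asboolP ngv] _].
    split => //; apply: lb_le_inf; first exact: (gap_on_neq0 gu).
    move=> _ [w gw <-]; rewrite leNgt; apply/negP => wm; apply: ngv.
    apply: (gap_on_intro tT (M0x o) (M0x v) gu.1 gw).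
    apply: (below_gromov tT (gu.2 _ gw)); apply: (le_trans (ltW wm)).
    exact: (gromov_between tT Oum Ovm).
have -> : mdist x y = mdist m (iota x) + mdist m (iota y).
  by rewrite -isoi; move: xym; rewrite /between/= (metric_sym m (iota x)) => ->.
apply: le_trans (lerD (half x y Oxm Oym) (half y x Oym Oxm)).
rewrite [X in _ <= X + _]big_mkcond [X in _ <= _ + X]big_mkcond -big_split/=.
apply: ler_sum => g _; rewrite /gap_length_on.
case: asboolP => gx; case: asboolP => gy /=; rewrite ?subrr ?normr0 ?addr0 ?add0r//.
  by rewrite subr0 ger0_norm// subr_ge0 ltW// (gap_bot_lt_top tT (M0x o) M0closed (M0x x)).
by rewrite normrN ger0_norm// subr_ge0 ltW// (gap_bot_lt_top tT (M0x o) M0closed (M0x y)).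
Qed.

Lemma gap_length_on_base g : gap_length_on g o = 0.
Proof.
rewrite /gap_length_on; case: asboolP => // -[gg gO].
have [u [_ nu] gu] := is_gap_point gg; exfalso; apply: nu; left.
suff <- : O = u by exact: M0x.
apply: mdist_positivity; have := gO _ gu; rewrite /between/= mdistxx.
by have := mdist_ge0 O u; have := mdist_ge0 u O; lra.
Qed.

Lemma gap_lip0_subproof g : gap_length_on g \in @lipschitz0 R M o.
Proof.
apply/asboolP; split; first exact: gap_length_on_base.
exists 1 => x y; rewrite mul1r.
by have := @gap_length_on_lipschitz [:: g] x y isT; rewrite big_seq1.
Qed.

Definition gap_lip0 g : lip0 o := Lip0 (gap_lip0_subproof g).

Lemma lip0_sumE (s : seq (set T)) (c : set T -> R) x :
  (\sum_(g <- s) c g *: gap_lip0 g) x = \sum_(g <- s) c g * gap_length_on g x.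
Proof.
have -> : (\sum_(g <- s) c g *: gap_lip0 g) x = delta o x (\sum_(g <- s) c g *: gap_lip0 g) by [].
by rewrite linear_sum; apply: eq_bigr => g _; rewrite linearZ.
Qed.

Lemma gap_lip0_sum_norm (s : seq (set T)) (c : set T -> R) : uniq s ->
  (forall g, `|c g| <= 1) -> `|\sum_(g <- s) c g *: gap_lip0 g| <= 1.
Proof.
move=> us c1; apply: lip0_norm_le => // x y; rewrite !lip0_sumE -sumrB mul1r.
apply: le_trans (gap_length_on_lipschitz x y us).
apply: (le_trans (ler_norm_sum _ _ _)); apply: ler_sum => g _.
by rewrite -mulrBr normrM ler_piMl.
Qed.

Definition gap_coord (u : lipfree o) g : R := lipfree_val u (gap_lip0 g).

Lemma gap_coord_sum_le (s : seq (set T)) (u : lipfree o) : uniq s ->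
  \sum_(g <- s) `|gap_coord u g| <= `|u|.
Proof.
move=> us; pose c g := Num.sg (gap_coord u g).
have c1 g : `|c g| <= 1.
  by rewrite /c normr_sg; case: (_ != 0); rewrite ?ler01// lexx.
have := lipfree_norm_ge u (gap_lip0_sum_norm us c1).
apply: le_trans; apply: le_trans (ler_norm _).
rewrite linear_sum; apply: ler_sum => g _.
by rewrite linearZ/= normrEsg.
Qed.

Lemma gap_coord_esum_le u : (\esum_(g in [set: set T]) `|gap_coord u g|%:E <= `|u|%:E)%E.
Proof.
apply: ge_ereal_sup => _ [A [finA _] <-].
rewrite fsbig_finite//= sumEFin lee_fin; apply: gap_coord_sum_le.
exact: finmap.fset_uniq.
Qed.

Lemma gap_coord_summable u : gap_coord u \in @summable_pred R (set T).
Proof.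
by apply/asboolP; rewrite /summable (le_lt_trans (gap_coord_esum_le u))// ltry.
Qed.

Definition tree_ell1 (u : lipfree o) : ell1 R (set T) := Ell1 (gap_coord_summable u).

Lemma tree_ell1_linear : linear tree_ell1.
Proof. by move=> a u v; apply: val_inj; apply/funext => g. Qed.

HB.instance Definition _ :=
  GRing.isLinear.Build R (lipfree o) (ell1 R (set T)) *:%R tree_ell1 tree_ell1_linear.

Lemma tree_ell1_norm_le u : `|tree_ell1 u| <= `|u|.
Proof. by rewrite -lee_fin ell1_normE; exact: gap_coord_esum_le. Qed.

Lemma mcshane_extension (f : M -> R) :
  (forall x y, `|f x - f y| <= mdist x y) ->
  exists F : T -> R, (forall u v, F v - F u <= mdist u v) /\
    forall x, F (iota x) = f x.
Proof.
move=> f1; pose S z := range (fun x => f x + mdist (iota x) z).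
have fle x y : f x <= f y + mdist (iota y) (iota x).
  by rewrite isoi metric_sym; have := f1 x y; rewrite ler_norml; lra.
have lbS z : has_lbound (S z).
  exists (f o - mdist O z) => _ [x _ <-].
  have := fle o x; have := metric_triangle (iota x) z O.
  by rewrite (metric_sym z O); lra.
have S0 z : S z !=set0 by exists (f o + mdist (iota o) z), o.
exists (fun z => inf (S z)); split.
  move=> u v; rewrite lerBlDr -lerBlDl; apply: lb_le_inf => // _ [x _ <-].
  have : inf (S v) <= f x + mdist (iota x) v by apply: ge_inf => //; exists x.
  by have := metric_triangle (iota x) u v; lra.
move=> x; apply/le_anti/andP; split.
  apply: (le_trans (ge_inf (lbS _) (_ : S (iota x) (f x + mdist (iota x) (iota x))))).
    by exists x.
  by rewrite mdistxx addr0.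
by apply: lb_le_inf => // _ [y _ <-]; exact: fle.
Qed.

Lemma lipfree_comb_eval n (a : 'I_n -> R) (x : 'I_n -> M) (f : lip0 o) :
  lipfree_val (\sum_(i < n) a i *: ldelta o (x i)) f = \sum_(i < n) a i * f (x i).
Proof. exact: (big_morph (fun u : lipfree o => lipfree_val u f)). Qed.

(** The coefficient of a gap is the slope across it of an extension of f to the
tree. *)
Lemma gap_approximation (f : lip0 o) e n (x : 'I_n -> M) : `|f| <= 1 -> 0 < e ->
  exists (s : seq (set T)) (c : set T -> R), [/\ uniq s,
    forall g, g \in s -> `|c g| <= 1 &
    forall i, `|f (x i) - \sum_(g <- s) c g * gap_length_on g (x i)| <= e].
Proof.
move=> f1 e0.
have [|F [F1 Ff]] := @mcshane_extension f.
  by move=> u v; apply: (le_trans (lip0_normP f u v)); rewrite ler_piMl ?mdist_ge0.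
have [D [D1 DF]] := lipschitz_increments tT (M0x o) M0closed F1.
have [s sP] := choice (fun i => gap_cover tT (M0x o) M0closed null_M0 null_branching
  (M0x (x i)) e0).
(* Gaps enough for all the points x i at once. *)
pose S := undup (flatten [seq s i | i <- enum 'I_n]).
have uS : uniq S by exact: undup_uniq.
have sub i g : g \in s i -> g \in S.
  move=> gi; rewrite mem_undup; apply/flattenP; exists (s i) => //.
  by apply/mapP; exists i => //; rewrite mem_enum.
have Sgap g : g \in S -> is_gap M0 g /\ 0 < gap_top O g - gap_bot O g.
  rewrite mem_undup => /flattenP[_ /mapP[i _ ->] gi].
  have [_ /(_ _ gi) gx _] := sP i.
  by rewrite subr_gt0; split; [exact: gx.1|exact: (gap_bot_lt_top tT (M0x o) M0closed (M0x (x i)))].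
exists S, (fun g => D g / (gap_top O g - gap_bot O g)); split => //.
  move=> g /Sgap[gg l0]; rewrite normrM normfV (gtr0_norm l0).
  by rewrite ler_pdivrMr// mul1r; exact: D1.
move=> i; pose P g := `[< gap_on M0 O (iota (x i)) g >].
have := DF (iota (x i)) [seq g <- S | P g] (M0x _) (filter_uniq _ uS).
have SiP g : g \in [seq g <- S | P g] -> gap_on M0 O (iota (x i)) g.
  by rewrite mem_filter => /andP[/asboolP].
move=> /(_ SiP); rewrite !Ff lip0_base subr0.
have -> : \sum_(g <- [seq g <- S | P g]) D g =
    \sum_(g <- S) D g / (gap_top O g - gap_bot O g) * gap_length_on g (x i).
  rewrite big_filter big_mkcond; apply: eq_big_seq => g /Sgap[_ l0].
  rewrite /gap_length_on -/(P g); case: ifP => _; last by rewrite mulr0.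
  by rewrite divfK// gt_eqF.
move=> /le_trans; apply.
have [us us_on us_len] := sP i; rewrite lerBlDr -lerBlDl; apply: (le_trans us_len).
have -> : \sum_(g <- s i) (gap_top O g - gap_bot O g) =
    \sum_(g <- [seq g <- S | P g] | g \in s i) (gap_top O g - gap_bot O g).
  rewrite -[RHS]big_filter; apply: perm_big; apply: uniq_perm => //.
    by rewrite !filter_uniq.
  move=> g; rewrite !mem_filter; case gi : (g \in s i) => //=.
  by rewrite (sub i)// andbT /P; apply/esym/asboolP/us_on.
rewrite [leRHS](bigID (fun g => g \in s i))/= lerDl.
rewrite big_seq_cond; apply: sumr_ge0 => g /andP[].
by rewrite mem_filter => /andP[_ /Sgap[_ /ltW]].
Qed.

Lemma tree_ell1_norm_ge n (a : 'I_n -> R) (x : 'I_n -> M) u :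
  u = \sum_(i < n) a i *: ldelta o (x i) -> `|u| <= `|tree_ell1 u|.
Proof.
move=> defu; apply: lipfree_norm_le => f f1; apply/ler_addgt0Pl => e e0.
pose A := \sum_(i < n) `|a i|.
have A0 : 0 <= A by exact: sumr_ge0.
have e1 : 0 < e / (A + 1) by rewrite divr_gt0// ltr_wpDl.
have [s [c [us c1 fs]]] := gap_approximation x f1 e1.
have uE (p : lip0 o) : lipfree_val u p = \sum_(i < n) a i * p (x i).
  by rewrite defu lipfree_comb_eval.
have -> : lipfree_val u f =
    \sum_(i < n) a i * (f (x i) - \sum_(g <- s) c g * gap_length_on g (x i)) +
    \sum_(g <- s) c g * gap_coord u g.
  rewrite uE; under [X in X + _]eq_bigr do rewrite mulrBr.
  rewrite sumrB -[LHS]addr0 -addrA; congr (_ + _); apply/esym/eqP.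
  rewrite addrC subr_eq0; apply/eqP.
  under eq_bigr do rewrite /gap_coord uE mulr_sumr.
  under [RHS]eq_bigr do rewrite mulr_sumr.
  rewrite exchange_big; apply: eq_bigr => i _; apply: eq_bigr => g _.
  by rewrite /=; ring.
apply: (le_trans (ler_normD _ _)); apply: lerD.
  apply: (le_trans (ler_norm_sum _ _ _)).
  apply: (@le_trans _ _ (\sum_(i < n) `|a i| * (e / (A + 1)))).
    by apply: ler_sum => i _; rewrite normrM ler_wpM2l.
  rewrite -mulr_suml -/A mulrCA ler_piMr//; first exact: ltW.
  by rewrite ler_pdivrMr ?ltr_wpDl// mul1r lerDl.
apply: (le_trans (ler_norm_sum _ _ _)).
apply: (@le_trans _ _ (\sum_(g <- s) `|tree_ell1 u g|)).
  rewrite big_seq [leRHS]big_seq; apply: ler_sum => g gs.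
  by rewrite normrM ler_piMl// c1.
rewrite -lee_fin ell1_normE -sumEFin; apply: esum_ge.
exists [set` s]; first by split => //; exact: finite_seq.
by rewrite -fsbig_seq.
Qed.

(** Both norms are continuous, and they agree on finite combinations of
evaluations. *)
Lemma tree_ell1_isometry u : `|tree_ell1 u| = `|u|.
Proof.
apply/le_anti; rewrite tree_ell1_norm_le/=; apply/ler_addgt0Pl => e e0.
have e2 : 0 < e / 2 by lra.
have /set_mem clu := lipfree_valP u.
have [|_ [[n [a [x ->]]] hv]] := clu (ball (lipfree_val u) (e / 2)).
  exact: nbhsx_ballx.
pose v := \sum_(i < n) a i *: ldelta o (x i).
have vE : lipfree_val v = \sum_(i < n) a i *: delta o (x i).
  exact: (big_morph (@lipfree_val R M o)).
have uv : `|u - v| < e / 2.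
  by move: hv; rewrite -ball_normE /= -vE.
have hvv : `|v| <= `|tree_ell1 v| by exact: tree_ell1_norm_ge.
have uE : u = (u - v) + v by rewrite subrK.
have vu : v = u - (u - v) by rewrite opprB addrC subrK.
apply: (@le_trans _ _ (`|u - v| + `|v|)); first by rewrite [X in `|X|]uE ler_normD.
have : `|tree_ell1 v| <= `|tree_ell1 u| + `|u - v|.
  rewrite [X in tree_ell1 X]vu linearB (le_trans (ler_normB _ _))// lerD2l.
  exact: tree_ell1_norm_le.
lra.
Qed.

End tree_to_ell1.

Lemma tree_ell1_embedding (R : realType) (M : completeMetricType R) (o : M)
    (T : metricType R) (iota : M -> T) :
  rtree T -> (forall x y, mdist (iota x) (iota y) = mdist x y) ->
  length_null (rconv (range iota)) (range iota) ->
  length_null (rconv (range iota))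
    (closure (branching (rconv (range iota))) `&` rconv (range iota)) ->
  exists (Gamma : choiceType) (J : {linear lipfree o -> ell1 R Gamma}),
    forall u, `|J u| = `|u|.
Proof.
move=> tT isoi nM nB; exists (set T : choiceType).
exists (tree_ell1 (o := o) tT isoi : {linear _ -> _}) => u.
exact: (tree_ell1_isometry tT isoi nM nB).
Qed.

(** * The equivalence *)

Theorem theorem1p1 (R : realType) (M : completeMetricType R) (o : M) :
  (exists (Gamma : choiceType) (J : {linear lipfree o -> ell1 R Gamma}),
     forall u, `|J u| = `|u|)
  <->
  (exists (T : metricType R) (iota : M -> T),
     [/\ rtree T,
         forall x y, mdist (iota x) (iota y) = mdist x y,
         length_null (rconv (range iota)) (range iota)
       & length_null (rconv (range iota))
           (closure (branching (rconv (range iota))) `&` rconv (range iota))]).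
Proof.
split=> [[Gamma [J Jiso]]|[T [iota [tT isoi nM nB]]]].
  exact: ell1_embedding_tree Jiso.
exact: (tree_ell1_embedding o tT isoi nM nB).
Qed.
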